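(* Let $\mathcal{K}\hookrightarrow\mathcal{L}$ be simplicial complexes, where $\mathcal{L}$ is $q$-non-branching. Then the up persistent Laplacian $\Delta_{q,\mathrm{up}}^{\mathcal{K},\mathcal{L}}$ can be computed in $$O\left((n_q^{\mathcal{L}}-n_q^{\mathcal{K}})\cdot\alpha(n_{q+1}^{\mathcal{L}})+n_{q+1}^{\mathcal{L}}+(n_q^{\mathcal{K}})^2\right)$$ arithmetic operations, where $\alpha(\cdot)$ is the inverse Ackermann function.
   Context: Simplicial complexes are finite. For a complex $X$, $n_q^X$ is the number of $q$-simplices of $X$. $\mathcal{L}$ is $q$-non-branching if every $q$-simplex of $\mathcal{L}$ is a face of at most two $(q+1)$-simplices of $\mathcal{L}$. Fix an orientation of each simplex of $\mathcal{L}$ (inherited by the subcomplex $\mathcal{K}$); $C_q^X$ is the real vector space with basis the oriented $q$-simplices of $X$ and $\partial_q^X:C_q^X\to C_{q-1}^X$ is the boundary operator. $\mathcal{K}$ and $\mathcal{L}$ carry positive weight functions $w^{\mathcal{K}},w^{\mathcal{L}}$ on simplices, and $C_q^X$ has the inner product for which distinct oriented simplices are orthogonal and $\langle[\sigma],[\sigma]\rangle=w^X(\sigma)^{-1}$. Set $C_{q+1}^{\mathcal{L},\mathcal{K}}=\{c\in C_{q+1}^{\mathcal{L}}:\partial_{q+1}^{\mathcal{L}}c\in C_q^{\mathcal{K}}\}$ with the inner product induced from $C_{q+1}^{\mathcal{L}}$, and let $\partial_{q+1}^{\mathcal{L},\mathcal{K}}:C_{q+1}^{\mathcal{L},\mathcal{K}}\to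 C_q^{\mathcal{K}}$ be the restriction of $\partial_{q+1}^{\mathcal{L}}$. The $q$-th up persistent Laplacian is $\partial_{q+1}^{\mathcal{L},\mathcal{K}}\circ(\partial_{q+1}^{\mathcal{L},\mathcal{K}})^{*}:C_q^{\mathcal{K}}\to C_q^{\mathcal{K}}$, where $*$ denotes the adjoint; $\Delta_{q,\mathrm{up}}^{\mathcal{K},\mathcal{L}}$ is its matrix in the basis of oriented $q$-simplices of $\mathcal{K}$. The input is the matrix of $\partial_{q+1}^{\mathcal{L}}$ in compressed sparse row format, the list of indices of the $q$-simplices of $\mathcal{K}$, and the diagonal weight matrices of $(q+1)$-simplices of $\mathcal{L}$ and $q$-simplices of $\mathcal{K}$. *)

(* Defs.v *)
From HB Require Import structures.
From mathcomp Require Import all_boot all_order all_algebra.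
From mathcomp Require Import reals.
From mathcomp Require classical_sets.
Set Implicit Arguments.
Unset Strict Implicit.
Unset Printing Implicit Defensive.
Import Order.TTheory GRing.Theory Num.Theory.
Local Open Scope ring_scope.

(* A complex is the set of its (nonempty) simplices, on a finite ambient vertex
   type.  Vertices of the ambient type need not belong to the complex. *)
Definition simplicial_complex (V : finType) (X : {set {set V}}) : Prop :=
  set0 \notin X /\
  forall s t : {set V}, s \in X -> t \subset s -> t != set0 -> t \in X.

Definition qsimp (V : finType) (X : {set {set V}}) (q : nat) :=
  {s : {set V} | (s \in X) && (#|s| == q.+1)}.

Definition nsimp (V : finType) (X : {set {set V}}) (q : nat) : nat :=
  #|{: qsimp X q}|.

Definition nonbranching (V : finType) (X : {set {set V}}) (q : nat) : Prop :=
  forall s : qsimp X q,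
    (#|[set t : qsimp X q.+1 | val s \subset val t]| <= 2)%N.

(* An orientation of a simplex is given by one ordering of its vertices;
   another ordering represents the same oriented simplex up to the sign of the
   permutation relating the two. *)
Definition orientation (V : finType) (X : {set {set V}})
    (ori : {set V} -> seq V) : Prop :=
  forall s, s \in X -> perm_eq (ori s) (enum s).

Fixpoint inversions (l : seq nat) : nat :=
  if l is x :: l' then (count (fun y => (y < x)%N) l' + inversions l')%N else 0%N.

Section Chains.
Context (R : realType) (V : finType) (ori : {set V} -> seq V).
Implicit Types (X K L : {set {set V}}) (q : nat) (w : {set V} -> R).

Definition chain X q := {ffun qsimp X q -> R^o}.

Definition basis_chain X q (s : qsimp X q) : chain X q :=
  [ffun s' => (s' == s)%:R].

(* The oriented simplex [v_0, ..., v_q] of a duplicate-free list of vertices: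
   plus or minus the basis chain of the underlying simplex, the sign being that
   of the permutation from the chosen ordering to the given one. *)
Definition ordered_chain X q (r : seq V) : chain X q :=
  [ffun s => if [set x in r] == val s
             then (-1) ^+ inversions [seq index x (ori (val s)) | x <- r]
             else 0].

Definition omit (i : nat) (r : seq V) : seq V := take i r ++ drop i.+1 r.

Definition boundary_fun X q (c : chain X q.+1) : chain X q :=
  \sum_(t : qsimp X q.+1)
     c t *: \sum_(i < q.+2) (-1) ^+ i *: ordered_chain X q (omit i (ori (val t))).

Lemma boundary_fun_is_linear X q : linear (@boundary_fun X q).
Proof.
move=> a c d; rewrite /boundary_fun scaler_sumr -big_split /=.
by apply: eq_bigr => t _; rewrite !ffunE scalerDl scalerA.
Qed.

HB.instance Definition _ X q :=
  GRing.isLinear.Build R (chain X q.+1) (chain X q) _ (@boundary_fun X q)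
    (@boundary_fun_is_linear X q).

Definition boundary X q : 'Hom(chain X q.+1, chain X q) :=
  linfun (@boundary_fun X q).

Definition chain_dot w X q (c d : chain X q) : R :=
  \sum_(s : qsimp X q) (c s : R) * (d s : R) * (w (val s))^-1.

Definition chain_incl_fun K L q (c : chain K q) : chain L q :=
  [ffun s : qsimp L q => oapp (c : qsimp K q -> R^o) 0 (insub (val s))].

Lemma chain_incl_fun_is_linear K L q : linear (@chain_incl_fun K L q).
Proof.
move=> a c d; apply/ffunP => s; rewrite !ffunE.
by case: insubP => [s' _ _|_] /=; rewrite ?ffunE ?scaler0 ?addr0.
Qed.

HB.instance Definition _ K L q :=
  GRing.isLinear.Build R (chain K q) (chain L q) _ (@chain_incl_fun K L q)
    (@chain_incl_fun_is_linear K L q).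

Definition chain_incl K L q : 'Hom(chain K q, chain L q) :=
  linfun (@chain_incl_fun K L q).

Definition pchain K L q : {vspace chain L q.+1} :=
  (boundary L q @^-1: limg (chain_incl K L q))%VS.

Definition pchain_dot w K L q (c d : subvs_of (pchain K L q)) : R :=
  chain_dot w (vsval c) (vsval d).

(* The inverse of the inclusion is only applied on its range, where it is a
   genuine inverse when K is a subcomplex of L. *)
Definition pboundary K L q : 'Hom(subvs_of (pchain K L q), chain K q) :=
  ((chain_incl K L q)^-1 \o boundary L q \o linfun vsval)%VF.

Definition is_adjoint (U W : vectType R) (dU : U -> U -> R) (dW : W -> W -> R)
    (f : 'Hom(U, W)) (g : 'Hom(W, U)) : Prop :=
  forall x y, dW (f x) y = dU x (g y).

Definition adjoint (U W : vectType R) (dU : U -> U -> R) (dW : W -> W -> R)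
    (f : 'Hom(U, W)) : 'Hom(W, U) :=
  classical_sets.xget 0 (fun g => is_adjoint dU dW f g).

Definition up_laplacian wK wL K L q : 'End(chain K q) :=
  (pboundary K L q \o
     adjoint (@pchain_dot wL K L q) (@chain_dot wK K q) (pboundary K L q))%VF.

Definition matrix_in X Y p q m n (row : 'I_m -> qsimp Y q)
    (col : 'I_n -> qsimp X p) (f : 'Hom(chain X p, chain Y q)) : 'M[R]_(m, n) :=
  \matrix_(i, j) f (basis_chain (col j)) (row i).

End Chains.

(* The adjoint above exists and is unique, so [xget] never falls back on its
   default value. *)
Section Adjoint.
Context (R : realType) (V : finType) (ori : {set V} -> seq V).

Lemma is_adjoint_exists (U W : vectType R)
    (dU : U -> {scalar U}) (dW : W -> {scalar W}) (f : 'Hom(U, W)) :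
  (forall u v, dU u v = dU v u) -> (forall u v, dW u v = dW v u) ->
  (forall u, dU u u = 0 -> u = 0) ->
  exists g, is_adjoint (fun u => dU u) (fun w => dW w) f g.
Proof.
move=> symU symW posU.
pose T (u : U) : 'Hom(U, R^o) := linfun (dU u : U -> R^o).
have TE u v : T u v = dU u v by rewrite /T lfunE.
have linT : linear T.
  move=> a u v; apply/lfunP => x; rewrite TE !lfunE /= lfunE /= !TE.
  by rewrite !(symU _ x) linearP.
pose TL : {linear U -> 'Hom(U, R^o)} := HB.pack T
  (GRing.isLinear.Build R U 'Hom(U, R^o) _ T linT).
pose TH := linfun TL.
have kerT : lker TH == 0%VS.
  apply/eqP/vspaceP => u; rewrite memv_ker memv0; apply/eqP/eqP => [|->].
    by rewrite lfunE /= => /lfunP /(_ u); rewrite TE lfunE /= => /posU ->.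
  by rewrite linear0.
have surjT phi : TH (TH^-1%VF phi) = phi.
  apply: limg_lfunVK; have -> : limg TH = fullv; last exact: memvf.
  apply/eqP; rewrite eqEdim subvf limg_dim_eq ?(eqP kerT) ?capv0 //.
  by rewrite !dimvf {1}/dim /= muln1.
pose S (w : W) : 'Hom(U, R^o) := (linfun (dW w : W -> R^o) \o f)%VF.
have SE w u : S w u = dW w (f u) by rewrite /S comp_lfunE lfunE.
have linS : linear S.
  move=> a u v; apply/lfunP => x; rewrite SE !lfunE /= lfunE /= !lfunE /= !lfunE /=.
  by rewrite !(symW _ (f x)) linearP.
pose SL : {linear W -> 'Hom(U, R^o)} := HB.pack S
  (GRing.isLinear.Build R W 'Hom(U, R^o) _ S linS).
exists (TH^-1 \o linfun SL)%VF => u w.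
rewrite comp_lfunE symU -TE.
have := surjT (SL w); rewrite [TH _]lfunE /= => E.
by rewrite [linfun SL w]lfunE /= E SE symW.
Qed.

Lemma chain_dotC (w : {set V} -> R) X q (c d : chain R X q) :
  chain_dot w c d = chain_dot w d c.
Proof. by apply: eq_bigr => s _; rewrite (mulrC (c s)). Qed.

Lemma chain_dot_is_linear (w : {set V} -> R) X q (c : chain R X q) :
  scalar (chain_dot w c).
Proof.
move=> a d e; rewrite /chain_dot mulr_sumr -big_split /=.
apply: eq_bigr => s _; rewrite !ffunE mulrDr mulrDl /GRing.scale /=.
by rewrite [c s * _]mulrCA !mulrA.
Qed.

Lemma chain_dot_eq0 (w : {set V} -> R) X q (c : chain R X q) :
  {in X, forall s, 0 < w s} -> chain_dot w c c = 0 -> c = 0.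
Proof.
move=> w0 /eqP; have wX (s : qsimp X q) : 0 < w (val s).
  by apply: w0; case/andP: (valP s).
rewrite psumr_eq0 => [/allP c0|s _]; last first.
  by apply: mulr_ge0; [exact: sqr_ge0 | rewrite invr_ge0 ltW].
apply/ffunP => s; have := c0 s (mem_index_enum s).
by rewrite /= mulf_eq0 invr_eq0 (gt_eqF (wX s)) orbF mulf_eq0 orbb ffunE => /eqP.
Qed.

Lemma pboundary_adjointP (wK wL : {set V} -> R) (K L : {set {set V}}) q :
  {in L, forall s, 0 < wL s} ->
  is_adjoint (@pchain_dot R V ori wL K L q) (@chain_dot R V wK K q)
    (pboundary R ori K L q)
    (adjoint (@pchain_dot R V ori wL K L q) (@chain_dot R V wK K q)
       (pboundary R ori K L q)).
Proof.
move=> wL0; apply: (@classical_sets.xgetPex _ 0 (fun g => is_adjoint _ _ _ g)).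
pose U := subvs_of (pchain R ori K L q).
have linU (u : U) : scalar (@pchain_dot R V ori wL K L q u).
  by move=> a v v'; rewrite /pchain_dot linearP chain_dot_is_linear.
pose dU (u : U) : {scalar U} := HB.pack (@pchain_dot R V ori wL K L q u)
  (GRing.isLinear.Build R U R _ _ (linU u)).
pose dW (c : chain R K q) : {scalar chain R K q} := HB.pack (chain_dot wK c)
  (GRing.isLinear.Build R (chain R K q) R _ _ (chain_dot_is_linear wK c)).
apply: (@is_adjoint_exists U (chain R K q) dU dW).
- by move=> u v; apply: chain_dotC.
- by move=> u v; apply: chain_dotC.
- by move=> u /chain_dot_eq0 u0; apply: val_inj; rewrite /= u0.
Qed.

Lemma is_adjoint_unique (U W : vectType R)
    (dU : U -> {scalar U}) (dW : W -> W -> R) (f : 'Hom(U, W)) g g' :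
  (forall u, dU u u = 0 -> u = 0) ->
  is_adjoint (fun u => dU u) dW f g -> is_adjoint (fun u => dU u) dW f g' ->
  g = g'.
Proof.
move=> posU fg fg'; apply/lfunP => w; apply/eqP; rewrite -subr_eq0; apply/eqP.
by apply: posU; rewrite linearB /= -fg -fg' subrr.
Qed.

Lemma chain_incl_ker0 (K L : {set {set V}}) q :
  K \subset L -> lker (chain_incl R K L q) == 0%VS.
Proof.
move=> KL; apply/lker0P => c d; rewrite !lfunE /= => /ffunP cd.
apply/ffunP => s; have sL : (val s \in L) && (#|val s| == q.+1).
  by case/andP: (valP s) => sK ->; rewrite (subsetP KL).
by have := cd (Sub (val s) sL); rewrite !ffunE SubK valK.
Qed.

(* [pboundary] is the restriction of the boundary operator of L. *)
Lemma pboundaryE (K L : {set {set V}}) q (c : subvs_of (pchain R ori K L q)) :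
  chain_incl R K L q (pboundary R ori K L q c) = boundary R ori L q (vsval c).
Proof.
rewrite !comp_lfunE [linfun _ c]lfunE /= limg_lfunVK //.
by have := subvsP c; rewrite /pchain -memv_preim.
Qed.

End Adjoint.

(* Row i lists, in any order, the (column, value) pairs of its nonzero entries;
   nothing else is stored. *)
Definition csr (R : realType) m n (M : 'M[R]_(m, n))
    (rowptr colind : seq nat) (vals : seq R) : Prop :=
  [/\ size rowptr = m.+1, nth 0%N rowptr 0 = 0%N & sorted leq rowptr] /\
  [/\ size colind = nth 0%N rowptr m,
      size vals = nth 0%N rowptr m &
      forall i : 'I_m,
        perm_eq [seq (nth 0%N colind k, nth 0 vals k)
                   | k <- index_iota (nth 0%N rowptr i) (nth 0%N rowptr i.+1)]
                [seq (val j, M i j) | j <- enum 'I_n & M i j != 0]].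

Fixpoint ackermann (m : nat) : nat -> nat :=
  if m is m'.+1 then
    fix ack n := if n is n'.+1 then ackermann m' (ack n') else ackermann m' 1
  else S.

Lemma ackermann_gt m n : (n < ackermann m n)%N.
Proof.
elim: m n => [//|m IHm]; elim=> [|n IHn]; first exact: leq_trans (IHm 1%N).
exact: leq_ltn_trans IHn (IHm _).
Qed.

Lemma inverse_ackermann_ex n : exists k, (0 < k)%N && (n <= ackermann k k)%N.
Proof. by exists n.+1; rewrite /= (leq_trans _ (ackermann_gt n.+1 n.+1)) ?leqW. Qed.

(* The least k >= 1 with n <= A(k, k); in particular it is never 0. *)
Definition inverse_ackermann (n : nat) : nat := ex_minn (inverse_ackermann_ex n).

(* A program is a finite text that mentions neither the input nor the reals.
   It computes with natural numbers (addition, truncated subtraction,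
   comparison) and with real numbers (field operations, comparison), both held
   in variables and in arrays.  Only natural numbers can be used as array
   indices, and there is no rounding of reals to naturals.  Division by 0 yields
   0. *)
Inductive nexpr :=
| NConst of nat
| NVar of nat
| NGet of nat & nexpr
| NAdd of nexpr & nexpr
| NSub of nexpr & nexpr.

Inductive rexpr :=
| RZero
| ROne
| RVar of nat
| RGet of nat & nexpr
| RAdd of rexpr & rexpr
| RSub of rexpr & rexpr
| RMul of rexpr & rexpr
| RDiv of rexpr & rexpr.

Inductive bexpr :=
| BNLt of nexpr & nexpr
| BRLt of rexpr & rexpr
| BNot of bexpr
| BAnd of bexpr & bexpr.

Inductive cmd :=
| Skip
| NAssign of nat & nexpr
| NStore of nat & nexpr & nexpr
| RAssign of nat & rexpr
| RStore of nat & nexpr & rexpr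
| Seq of cmd & cmd
| If of bexpr & cmd & cmd
| While of bexpr & cmd.

(* Every constant, memory access, arithmetic operation, comparison, Boolean
   operation, assignment and branch costs one unit, so a bound on the cost bounds
   in particular the number of arithmetic operations. *)
Fixpoint ncost (e : nexpr) : nat :=
  match e with
  | NConst _ | NVar _ => 1
  | NGet _ e => (ncost e).+1
  | NAdd e1 e2 | NSub e1 e2 => (ncost e1 + ncost e2).+1
  end.

Fixpoint rcost (e : rexpr) : nat :=
  match e with
  | RZero | ROne | RVar _ => 1
  | RGet _ e => (ncost e).+1
  | RAdd e1 e2 | RSub e1 e2 | RMul e1 e2 | RDiv e1 e2 => (rcost e1 + rcost e2).+1
  end.

Fixpoint bcost (b : bexpr) : nat :=
  match b with
  | BNLt e1 e2 => (ncost e1 + ncost e2).+1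
  | BRLt e1 e2 => (rcost e1 + rcost e2).+1
  | BNot b => (bcost b).+1
  | BAnd b1 b2 => (bcost b1 + bcost b2).+1
  end.

Section Semantics.
Context (R : realType).

Record state := State {
  nvar : nat -> nat;
  narr : nat -> nat -> nat;
  rvar : nat -> R;
  rarr : nat -> nat -> R }.

Fixpoint neval (s : state) (e : nexpr) : nat :=
  match e with
  | NConst n => n
  | NVar x => nvar s x
  | NGet a e => narr s a (neval s e)
  | NAdd e1 e2 => (neval s e1 + neval s e2)%N
  | NSub e1 e2 => (neval s e1 - neval s e2)%N
  end.

Fixpoint reval (s : state) (e : rexpr) : R :=
  match e with
  | RZero => 0
  | ROne => 1
  | RVar x => rvar s x
  | RGet a e => rarr s a (neval s e)
  | RAdd e1 e2 => reval s e1 + reval s e2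
  | RSub e1 e2 => reval s e1 - reval s e2
  | RMul e1 e2 => reval s e1 * reval s e2
  | RDiv e1 e2 => reval s e1 / reval s e2
  end.

Fixpoint beval (s : state) (b : bexpr) : bool :=
  match b with
  | BNLt e1 e2 => (neval s e1 < neval s e2)%N
  | BRLt e1 e2 => reval s e1 < reval s e2
  | BNot b => ~~ beval s b
  | BAnd b1 b2 => beval s b1 && beval s b2
  end.

Definition upd T (f : nat -> T) (i : nat) (v : T) : nat -> T :=
  fun j => if j == i then v else f j.

Definition upd2 T (f : nat -> nat -> T) (a i : nat) (v : T) : nat -> nat -> T :=
  upd f a (upd (f a) i v).

(* [exec c s t n]: started in s, the command c halts in t after n operations. *)
Inductive exec : cmd -> state -> state -> nat -> Prop :=
| ExecSkip s : exec Skip s s 0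
| ExecNAssign x e s :
    exec (NAssign x e) s
      (State (upd (nvar s) x (neval s e)) (narr s) (rvar s) (rarr s))
      (ncost e).+1
| ExecNStore a i e s :
    exec (NStore a i e) s
      (State (nvar s) (upd2 (narr s) a (neval s i) (neval s e)) (rvar s) (rarr s))
      (ncost i + ncost e).+1
| ExecRAssign x e s :
    exec (RAssign x e) s
      (State (nvar s) (narr s) (upd (rvar s) x (reval s e)) (rarr s))
      (rcost e).+1
| ExecRStore a i e s :
    exec (RStore a i e) s
      (State (nvar s) (narr s) (rvar s) (upd2 (rarr s) a (neval s i) (reval s e)))
      (ncost i + rcost e).+1
| ExecSeq c1 c2 s1 s2 s3 n1 n2 :
    exec c1 s1 s2 n1 -> exec c2 s2 s3 n2 -> exec (Seq c1 c2) s1 s3 (n1 + n2)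
| ExecIfTrue b c1 c2 s t n :
    beval s b -> exec c1 s t n -> exec (If b c1 c2) s t (bcost b + n).+1
| ExecIfFalse b c1 c2 s t n :
    ~~ beval s b -> exec c2 s t n -> exec (If b c1 c2) s t (bcost b + n).+1
| ExecWhileTrue b c s1 s2 s3 n1 n2 :
    beval s1 b -> exec c s1 s2 n1 -> exec (While b c) s2 s3 n2 ->
    exec (While b c) s1 s3 (bcost b + n1 + n2).+1
| ExecWhileFalse b c s :
    ~~ beval s b -> exec (While b c) s s (bcost b).+1.

(* The listed values are stored in variables 0, 1, ... and arrays 0, 1, ...; all
   other cells initially contain 0. *)
Definition input_state (nvars : seq nat) (narrs : seq (seq nat))
    (rarrs : seq (seq R)) : state :=
  State (fun x => nth 0%N nvars x)
        (fun a i => nth 0%N (nth [::] narrs a) i)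
        (fun _ => 0)
        (fun a i => nth 0 (nth [::] rarrs a) i).

End Semantics.

(* Main.v *)
Require Import Defs.
From mathcomp Require Import all_boot all_order all_algebra.
From mathcomp Require Import reals.
From mathcomp Require Import zify ring.
Set Implicit Arguments.
Unset Strict Implicit.
Unset Printing Implicit Defensive.
Import Order.TTheory GRing.Theory Num.Theory.
Local Open Scope ring_scope.

(** A (q+1)-chain of [L] has its boundary in [K] exactly when it is annihilated by
    the rows of the boundary matrix that belong to the q-simplices outside [K].
    Since [L] is q-non-branching, such a row has at most two nonzero entries
    ([row_entries_le2]): it either expresses one coordinate through another or
    forces a coordinate to vanish. Linking the two columns of every row of the
    first kind groups the columns into classes, and on each class a persistent
    chain is determined by its coordinate at a root: it is a multiple of one
    vector [x]. Either [x], restricted to the class, is itself a persistent chain,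
    or some row is violated and every persistent chain vanishes on the class
    ([bad_class]). The persistent chains therefore have an orthogonal basis of
    vectors with disjoint supports, which makes the orthogonal projection onto them
    explicit ([proj_cycle], [proj_dot]). The Laplacian is this projection between
    two boundary operators ([up_laplacian_entry]). As a row has at most two entries,
    each of the [nK ^ 2] entries of the Laplacian is a sum of four products, [nK]
    being the number of q-simplices of [K].

    All links between columns are known in advance, so the classes and [x] are found
    by one depth-first search on adjacency lists ([search_correct]), whose time is
    linear in the numbers of q- and (q+1)-simplices of [L]. The number [nL] of
    q-simplices of [L] is [(nL - nK) + nK], and the inverse Ackermann function is at
    least 1, so the total stays within the bound ([program_cost_le]).

    The program is a sequence of loops with loop-free bodies. Each loop is
    verified with an invariant that carries a potential, the number of iterations
    that can still be paid for ([computes_while]). *)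

(** * Running programs *)

(** [maxcost] and [run] below are meant for loop-free commands; their values on
    loops are defaults. *)
Fixpoint loopfree (c : cmd) : bool :=
  match c with
  | Seq c1 c2 | If _ c1 c2 => loopfree c1 && loopfree c2
  | While _ _ => false
  | _ => true
  end.

Fixpoint maxcost (c : cmd) : nat :=
  match c with
  | Skip | While _ _ => 0
  | NAssign _ e => (ncost e).+1
  | NStore _ i e => (ncost i + ncost e).+1
  | RAssign _ e => (rcost e).+1
  | RStore _ i e => (ncost i + rcost e).+1
  | Seq c1 c2 => maxcost c1 + maxcost c2
  | If b c1 c2 => (bcost b + maxn (maxcost c1) (maxcost c2)).+1
  end.

(** Syntactic write sets: a cell outside them survives the command, so that no
    loop invariant has to mention the data that its loop leaves alone. *)
Fixpoint written_nvars (c : cmd) : seq nat :=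
  match c with
  | NAssign x _ => [:: x]
  | Seq c1 c2 | If _ c1 c2 => written_nvars c1 ++ written_nvars c2
  | While _ c => written_nvars c
  | _ => [::]
  end.

Fixpoint written_narrs (c : cmd) : seq nat :=
  match c with
  | NStore a _ _ => [:: a]
  | Seq c1 c2 | If _ c1 c2 => written_narrs c1 ++ written_narrs c2
  | While _ c => written_narrs c
  | _ => [::]
  end.

Fixpoint written_rarrs (c : cmd) : seq nat :=
  match c with
  | RStore a _ _ => [:: a]
  | Seq c1 c2 | If _ c1 c2 => written_rarrs c1 ++ written_rarrs c2
  | While _ c => written_rarrs c
  | _ => [::]
  end.

Section Running.
Context (R : realType).
Implicit Types (c : cmd) (s t : state R).

Definition set_nvar s x v := State (upd (nvar s) x v) (narr s) (rvar s) (rarr s).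
Definition set_narr s a i v :=
  State (nvar s) (upd2 (narr s) a i v) (rvar s) (rarr s).
Definition set_rvar s x v := State (nvar s) (narr s) (upd (rvar s) x v) (rarr s).
Definition set_rarr s a i v :=
  State (nvar s) (narr s) (rvar s) (upd2 (rarr s) a i v).

Fixpoint run c s : state R :=
  match c with
  | Skip | While _ _ => s
  | NAssign x e => set_nvar s x (neval s e)
  | NStore a i e => set_narr s a (neval s i) (neval s e)
  | RAssign x e => set_rvar s x (reval s e)
  | RStore a i e => set_rarr s a (neval s i) (reval s e)
  | Seq c1 c2 => run c2 (run c1 s)
  | If b c1 c2 => if beval s b then run c1 s else run c2 s
  end.

(** The condition for [Q] to hold after [c]. Every value written gets a name, so
    that symbolic execution does not duplicate expressions. *)
Fixpoint wp c (Q : state R -> Prop) s : Prop :=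
  match c with
  | Skip | While _ _ => Q s
  | NAssign x e => forall v, v = neval s e -> Q (set_nvar s x v)
  | NStore a i e =>
      forall j v, j = neval s i -> v = neval s e -> Q (set_narr s a j v)
  | RAssign x e => forall v, v = reval s e -> Q (set_rvar s x v)
  | RStore a i e =>
      forall j v, j = neval s i -> v = reval s e -> Q (set_rarr s a j v)
  | Seq c1 c2 => wp c1 (wp c2 Q) s
  | If b c1 c2 => if beval s b then wp c1 Q s else wp c2 Q s
  end.

Lemma wpP c Q s : wp c Q s <-> Q (run c s).
Proof.
elim: c Q s => //= [x e|a i e|x e|a i e|c1 IH1 c2 IH2|b c1 IH1 c2 IH2] Q s.
- by split=> [h|h v -> //]; apply: h.
- by split=> [h|h j v -> -> //]; apply: h.
- by split=> [h|h v -> //]; apply: h.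
- by split=> [h|h j v -> -> //]; apply: h.
- by rewrite IH1 IH2.
- by case: ifP; rewrite ?IH1 ?IH2.
Qed.

Lemma run_exec c s :
  loopfree c -> exists2 n, exec c s (run c s) n & (n <= maxcost c)%N.
Proof.
elim: c s => [|x e|a i e|x e|a i e|c1 IH1 c2 IH2|b c1 IH1 c2 IH2|//] s /=;
  try by move=> _; eexists; first by constructor.
- case/andP=> /IH1-/(_ s)[n1 e1 l1] /IH2-/(_ (run c1 s))[n2 e2 l2].
  by exists (n1 + n2)%N; [apply: ExecSeq e1 e2 | apply: leq_add].
- case/andP=> /IH1-/(_ s)[n1 e1 l1] /IH2-/(_ s)[n2 e2 l2].
  have [hb|hb] := boolP (beval s b).
    exists (bcost b + n1).+1; first exact: ExecIfTrue.
    by rewrite ltnS leq_add2l leq_max l1.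
  exists (bcost b + n2).+1; first exact: ExecIfFalse.
  by rewrite ltnS leq_add2l leq_max l2 orbT.
Qed.

Definition agree c s t : Prop :=
  [/\ forall x, x \notin written_nvars c -> nvar t x = nvar s x,
      forall a, a \notin written_narrs c -> narr t a = narr s a &
      forall a, a \notin written_rarrs c -> rarr t a = rarr s a].

Lemma agree_trans c s1 s2 s3 : agree c s1 s2 -> agree c s2 s3 -> agree c s1 s3.
Proof.
move=> [n1 a1 r1] [n2 a2 r2].
by split=> z hz; [rewrite n2 ?n1 | rewrite a2 ?a1 | rewrite r2 ?r1].
Qed.

Lemma agree_seq c1 c2 s1 s2 s3 :
  agree c1 s1 s2 -> agree c2 s2 s3 -> agree (Seq c1 c2) s1 s3.
Proof.
move=> [n1 a1 r1] [n2 a2 r2].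
by split=> z /=; rewrite mem_cat negb_or => /andP[h1 h2];
  [rewrite n2 ?n1 | rewrite a2 ?a1 | rewrite r2 ?r1].
Qed.

Lemma exec_agree c s t n : exec c s t n -> agree c s t.
Proof.
have upd_out T (f : nat -> T) i v j : j \notin [:: i] -> upd f i v j = f j.
  by rewrite inE /upd => /negPf->.
elim=> {c s t n} //=.
- by move=> x e s; split=> // z zi; exact: upd_out.
- by move=> a i e s; split=> // z zi; exact: upd_out.
- by move=> a i e s; split=> // z zi; exact: upd_out.
- by move=> c1 c2 s1 s2 s3 n1 n2 _ h1 _ h2; apply: agree_seq h1 h2.
- move=> b c1 c2 s t n _ _ [h1 h2 h3]; split=> z /=.
  + by rewrite mem_cat negb_or => /andP[/h1].
  + by rewrite mem_cat negb_or => /andP[/h2].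
  + by rewrite mem_cat negb_or => /andP[/h3].
- move=> b c1 c2 s t n _ _ [h1 h2 h3]; split=> z /=.
  + by rewrite mem_cat negb_or => /andP[_ /h1].
  + by rewrite mem_cat negb_or => /andP[_ /h2].
  + by rewrite mem_cat negb_or => /andP[_ /h3].
- by move=> b c s1 s2 s3 n1 n2 _ _ h1 _ h2; apply: agree_trans h1 h2.
Qed.

Lemma run_agree c s : loopfree c -> agree c s (run c s).
Proof. by case/(run_exec s) => n /exec_agree. Qed.

(** Total correctness with a cost bound. *)
Definition computes c s (B : nat) (Q : state R -> Prop) : Prop :=
  exists t n, [/\ exec c s t n, (n <= B)%N & Q t].

Lemma computes_run c s (Q : state R -> Prop) :
  loopfree c -> Q (run c s) -> computes c s (maxcost c) Q.
Proof. by move=> /(run_exec s)[n e l] q; exists (run c s), n. Qed.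

Lemma computes_impl c s B B' (Q Q' : state R -> Prop) :
  computes c s B Q -> (B <= B')%N -> (forall t, agree c s t -> Q t -> Q' t) ->
  computes c s B' Q'.
Proof.
move=> [t [n [e l q]]] lB QQ; exists t, n.
by split; [| exact: leq_trans lB | exact: QQ (exec_agree e) q].
Qed.

Lemma computes_seq c1 c2 s B1 B2 (Q1 Q2 : state R -> Prop) :
  computes c1 s B1 Q1 ->
  (forall t, agree c1 s t -> Q1 t -> computes c2 t B2 Q2) ->
  computes (Seq c1 c2) s (B1 + B2) Q2.
Proof.
move=> [t1 [n1 [e1 l1 q1]]] /(_ _ (exec_agree e1) q1)[t2 [n2 [e2 l2 q2]]].
exists t2, (n1 + n2)%N; split=> //; [exact: ExecSeq e1 e2 | exact: leq_add].
Qed.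

(** The invariant carries a potential that pays for the remaining iterations:
    it gives termination and amortises the cost at the same time. *)
Lemma computes_while b c (I : nat -> state R -> Prop) s k :
  loopfree c -> I k s ->
  (forall k t, agree c s t -> I k t -> beval t b ->
     wp c (fun t' => exists2 k', (k' < k)%N & I k' t') t) ->
  computes (While b c) s (k * (bcost b + maxcost c).+1 + (bcost b).+1)
    (fun t => ~~ beval t b /\ exists k', I k' t).
Proof.
move=> lf + step; suff H s1 : agree c s s1 -> I k s1 ->
    computes (While b c) s1 (k * (bcost b + maxcost c).+1 + (bcost b).+1)
      (fun t => ~~ beval t b /\ exists k', I k' t) by apply: H.
elim/ltn_ind: k s1 => k IH s1 a1 i1.
have [hb|hb] := boolP (beval s1 b); last first.
  exists s1, (bcost b).+1; split; [exact: ExecWhileFalse|exact: leq_addl|].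
  by split=> //; exists k.
have [k' lk i2] := (wpP _ _ _).1 (step _ _ a1 i1 hb).
have [|t [n [e l q]]] := IH _ lk (run c s1) _ i2.
  exact: agree_trans a1 (run_agree _ lf).
have [m e1 l1] := run_exec s1 lf.
exists t, (bcost b + m + n).+1; split=> //; first exact: ExecWhileTrue e1 e.
apply: leq_trans (_ : k'.+1 * (bcost b + maxcost c).+1 + (bcost b).+1 <= _)%N.
  by rewrite mulSn -[X in (_ <= X)%N]addnA -addSn leq_add // ltnS leq_add2l.
by rewrite leq_add2r leq_mul2r lk orbT.
Qed.

End Running.

Definition incr x := NAssign x (NAdd (NVar x) (NConst 1)).

(** The counter [x] runs from 0 up to the value of the variable [m]. *)
Definition For x m c :=
  Seq (NAssign x (NConst 0)) (While (BNLt (NVar x) (NVar m)) (Seq c (incr x))).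

(** An iteration pays 4 for the test and the branch and 4 for the increment; the
    initialisation and the last test cost 6. *)
Definition for_cost c N := (N * (maxcost c + 8) + 6)%N.

Lemma for_costE c N :
  (2 + (N * (3 + (maxcost c + 4)).+1 + 4))%N = for_cost c N.
Proof. by rewrite /for_cost; lia. Qed.

Lemma computes_for (R : realType) x m c N (I : nat -> state R -> Prop) s :
  loopfree c -> x != m -> x \notin written_nvars c -> m \notin written_nvars c ->
  nvar s m = N -> I 0%N (set_nvar s x 0%N) ->
  (forall i t, (i < N)%N -> agree (Seq c (incr x)) s t -> nvar t x = i -> I i t ->
     wp c (fun t' => I i.+1 (set_nvar t' x i.+1)) t) ->
  computes (For x m c) s (for_cost c N) (I N).
Proof.
move=> lf xm xc mc sm I0 step; rewrite -for_costE.
apply: (computes_seq (Q1 := fun t => t = set_nvar s x 0%N)).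
  by apply: (computes_run (c := NAssign x (NConst 0))).
move=> _ _ ->; set s0 := set_nvar _ _ _.
have ag0 : agree (Seq c (incr x)) s s0.
  split=> // z; rewrite /= mem_cat inE negb_or => /andP[_ /negPf zx].
  by rewrite /upd zx.
pose J k (t : state R) :=
  [/\ (nvar t x + k = N)%N, nvar t m = N & I (nvar t x) t].
have [|||t [n [e l [hb [k [tk tm It]]]]]] :=
    @computes_while R (BNLt (NVar x) (NVar m)) (Seq c (incr x)) J s0 N.
- by rewrite /= lf.
- by rewrite /J /s0 /= /upd eqxx eq_sym (negPf xm) add0n.
- move=> k t agt [tk tm It] /= lt; apply/wpP => _ ->.
  case: k tk => [|k] tk; first by rewrite tm -tk addn0 ltnn in lt.
  have [an _ _] := run_agree t lf.
  exists k => //; rewrite /J /= /upd eqxx eq_sym (negPf xm) an // an // tm addn1.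
  rewrite addSn -addnS; split=> //.
  by rewrite tm in lt; have /wpP := step _ _ lt (agree_trans ag0 agt) erefl It.
exists t, n; split=> //.
move: hb tk It; rewrite /= tm -leqNgt => le tk.
by rewrite (_ : nvar t x = N) //; apply/eqP; rewrite eqn_leq le -tk leq_addr.
Qed.

(** * The persistent Laplacian through an orthogonal projection *)

Section Projection.
Context (R : realType) (V : finType) (K L : {set {set V}}) (q : nat).
Context (ori : {set V} -> seq V) (wK wL : {set V} -> R).
Context (rowL : 'I_(nsimp L q) -> qsimp L q).
Context (colL : 'I_(nsimp L q.+1) -> qsimp L q.+1).
Context (rowK : 'I_(nsimp K q) -> qsimp K q).
Context (idx : 'I_(nsimp K q) -> 'I_(nsimp L q)).
Hypothesis wL0 : {in L, forall s, 0 < wL s}.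
Hypotheses (bijL : bijective rowL) (bijC : bijective colL).
Hypotheses (bijK : bijective rowK).
Hypothesis idxE : forall i, val (rowL (idx i)) = val (rowK i).

Let M := matrix_in rowL colL (boundary R ori L q).

Lemma chain_scaleE (X : {set {set V}}) p k (d : chain R X p) s :
  (k *: d) s = k * (d s : R) :> R.
Proof. by rewrite ffunE. Qed.

Lemma boundaryE (c : chain R L q.+1) i :
  boundary R ori L q c (rowL i) = \sum_a M i a * (c (colL a) : R).
Proof.
have {1}-> : c = \sum_t c t *: basis_chain R t.
  apply/ffunP => s.
  have E t : (c t *: basis_chain R t : chain R L q.+1) s
             = (c t : R) * (s == t)%:R :> R.
    by apply: etrans (chain_scaleE _ _ _) _; rewrite ffunE.
  rewrite sum_ffunE; apply/esym; rewrite (eq_bigr _ (fun t _ => E t)).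
  rewrite (bigD1 s) //= eqxx mulr1 big1 ?addr0 // => t.
  by rewrite eq_sym mulrb => /negPf->; rewrite mulr0.
rewrite linear_sum sum_ffunE (reindex colL) /=; last exact: onW_bij.
by apply: eq_bigr => a _; rewrite linearZ chain_scaleE mxE mulrC.
Qed.

Lemma mem_pchain (c : chain R L q.+1) :
  (c \in pchain R ori K L q) <->
  (forall i, i \notin codom idx -> \sum_a M i a * (c (colL a) : R) = 0).
Proof.
rewrite /pchain -memv_preim; split=> [/memv_imgP[d _ cd] i iK|zero].
  rewrite -boundaryE cd lfunE /= ffunE insubF //; apply/negbTE.
  apply: contra iK => siK; have [g _ gK] := bijK.
  apply/codomP; exists (g (Sub (val (rowL i)) siK)).
  by apply: (bij_inj bijL); apply: val_inj; rewrite idxE gK.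
apply/memv_imgP; have [g gK rK] := bijK.
exists [ffun s => boundary R ori L q c (rowL (idx (g s)))]; first exact: memvf.
have [h _ hK] := bijL; apply/ffunP => s.
rewrite [chain_incl _ _ _ _ _]lfunE /= [chain_incl_fun _ _ _]ffunE.
case: insubP => [s' _ ss'|sK] /=; first rewrite ffunE; last first.
  rewrite -[s]hK boundaryE zero //; apply: contra sK => /codomP[i si].
  by rewrite -[s]hK si idxE; apply: (valP (rowK i)).
by congr (_ _); apply: val_inj; rewrite idxE rK.
Qed.

Lemma pboundary_row (u : subvs_of (pchain R ori K L q)) i :
  (pboundary R ori K L q u (rowK i) : R) =
  \sum_a M (idx i) a * (vsval u (colL a) : R).
Proof.
rewrite -boundaryE -pboundaryE.
rewrite [chain_incl _ _ _ _ _]lfunE /= [chain_incl_fun _ _ _]ffunE idxE.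
by case: insubP => [s' _ /val_inj -> //|]; rewrite (valP (rowK i)).
Qed.

Lemma chain_dot_basis (c : chain R K q) j :
  chain_dot wK c (basis_chain R (rowK j)) =
  (c (rowK j) : R) * (wK (val (rowK j)))^-1.
Proof.
rewrite /chain_dot (bigD1 (rowK j)) //= big1 => [|s /negPf sj].
  by rewrite ffunE eqxx mulr1 addr0.
by rewrite ffunE sj mulr0 mul0r.
Qed.

(** Up to the weights, [P] is the matrix of the orthogonal projection onto the
    persistent chains: its columns are such chains, and the inner product of a
    persistent chain with column [b] is the coefficient of that chain at [b].
    Composing the adjoint with the boundary then sandwiches [P] between the rows
    of [M] that belong to [K]; the adjoint is recognised because the difference
    to the candidate is a persistent chain orthogonal to itself. *)
Lemma up_laplacian_entry (P : 'I_(nsimp L q.+1) -> 'I_(nsimp L q.+1) -> R) :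
  (forall b i, i \notin codom idx -> \sum_a M i a * P a b = 0) ->
  (forall u : 'I_(nsimp L q.+1) -> R,
     (forall i, i \notin codom idx -> \sum_a M i a * u a = 0) ->
     forall b, \sum_a u a * P a b * (wL (val (colL a)))^-1 = u b) ->
  forall i j,
  matrix_in rowK rowK (up_laplacian ori wK wL K L q) i j =
  \sum_a \sum_b M (idx i) a * P a b * M (idx j) b * (wK (val (rowK j)))^-1.
Proof.
move=> Pcycle Pproj i j; rewrite mxE comp_lfunE.
set y := basis_chain R (rowK j).
have := @pboundary_adjointP R V ori wK wL K L q wL0.
set g := adjoint _ _ _ => adjg.
pose zfun a := \sum_b P a b * M (idx j) b * (wK (val (rowK j)))^-1.
have [h Ch hC] := bijC.
pose z : chain R L q.+1 := [ffun t => zfun (h t) : R^o].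
have zE a : z (colL a) = zfun a by rewrite ffunE Ch.
have zP : z \in pchain R ori K L q.
  apply/mem_pchain => k kK; under eq_bigr do rewrite zE mulr_sumr.
  rewrite exchange_big /= big1 // => b _.
  under eq_bigr do rewrite !mulrA.
  by rewrite -!mulr_suml Pcycle // !mul0r.
pose Z := vsproj (pchain R ori K L q) z.
have ZE : vsval Z = z by rewrite vsprojK.
have dotZ u : pchain_dot wL u Z = chain_dot wK (pboundary R ori K L q u) y.
  rewrite chain_dot_basis pboundary_row /pchain_dot /chain_dot ZE.
  rewrite (reindex colL) /=; last exact: onW_bij.
  under eq_bigr do rewrite zE mulr_sumr mulr_suml.
  rewrite exchange_big /= mulr_suml; apply: eq_bigr => b _.
  have /mem_pchain uP := subvsP u.
  rewrite -[vsval u (colL b)](Pproj (fun a => vsval u (colL a)) uP b).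
  by rewrite mulr_sumr mulr_suml; apply: eq_bigr => a _; ring.
have -> : g y = Z.
  apply/eqP; rewrite -subr_eq0; apply/eqP/val_inj.
  set D := g y - Z; apply: (@chain_dot_eq0 R V wL L q.+1) => //.
  have {2}-> : \val D = -1 *: vsval Z + vsval (g y).
    by rewrite scaleN1r addrC -linearB.
  have -> : forall c d e : chain R L q.+1,
      chain_dot wL c (-1 *: d + e) = chain_dot wL c e - chain_dot wL c d.
    by move=> c d e; rewrite chain_dot_is_linear mulN1r addrC.
  rewrite -[chain_dot _ _ (vsval (g y))]/(pchain_dot wL D (g y)).
  by rewrite -[chain_dot _ _ (vsval Z)]/(pchain_dot wL D Z) dotZ -adjg subrr.
rewrite pboundary_row ZE; apply: eq_bigr => a _.
rewrite zE mulr_sumr; apply: eq_bigr => b _; ring.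
Qed.

End Projection.

(** * Systems with at most two unknowns per equation *)

Section TwoSlots.
Context (R : realFieldType) (nr n : nat) (inK : nat -> bool).
Context (c1 c2 : nat -> nat) (v1 v2 : nat -> R) (wt : nat -> R).
Implicit Types (u x norm : nat -> R) (lab : nat -> nat).

Definition free_row i : bool := (i < nr)%N && ~~ inK i.

Definition row_dot i u : R := v1 i * u (c1 i) + v2 i * u (c2 i).

Definition cycle u : Prop := forall i, free_row i -> row_dot i u = 0.

(** A column index matters only when its coefficient is nonzero, and the first
    slot is used before the second. *)
Definition slots_ok : Prop :=
  forall i, (i < nr)%N ->
    [/\ v1 i != 0 -> (c1 i < n)%N, v2 i != 0 -> (c2 i < n)%N &
        v2 i != 0 -> v1 i != 0].

(** Columns are grouped into classes whose coordinates in every cycle are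
    determined by the one at the root. A label is the root plus one, so that 0
    can mean that a column has not been reached. *)
Definition spanned lab x a : Prop :=
  [/\ (lab a <= n)%N, lab (lab a).-1 = lab a, x (lab a).-1 = 1 &
      forall u, cycle u -> u a = x a * u (lab a).-1].

Definition sqnorm lab x r : R := \sum_(a < n | lab a == r) x a ^+ 2 / wt a.

Definition bad lab x i r : bool :=
  [&& free_row i, row_dot i x != 0 & lab (c1 i) == r].

(** The squared norm of each class, or 0 when some equation forces the
    coordinates of the class to vanish. *)
Definition norm_ok lab x norm r : Prop :=
  (forall i, ~~ bad lab x i r) /\ norm r = sqnorm lab x r \/
  (exists i, bad lab x i r) /\ norm r = 0.

(** As dividing by 0 yields 0, the columns of a class of norm 0 vanish. *)
Definition proj lab x norm a b : R :=
  if lab a == lab b then x a * x b / norm (lab a) else 0.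

Section Proj.
Context (lab : nat -> nat) (x norm : nat -> R).
Hypotheses (wt0 : forall a, (a < n)%N -> 0 < wt a) (slots : slots_ok).
Hypothesis lab_gt0 : forall a, (a < n)%N -> (0 < lab a)%N.
Hypothesis lab_spans : forall a, (a < n)%N -> spanned lab x a.
Hypothesis lab_edge : forall i, free_row i -> v2 i != 0 -> lab (c1 i) = lab (c2 i).
Hypothesis normP : forall a, (a < n)%N -> norm_ok lab x norm (lab a).

Lemma row_dot_neq0 i u : (i < nr)%N -> row_dot i u != 0 -> (c1 i < n)%N.
Proof.
move=> /slots[h1 _ h12] ne; apply: h1; apply: contraNneq ne => v10.
have [v20|/h12] := eqVneq (v2 i) 0; last by rewrite v10 eqxx.
by rewrite /row_dot v10 v20 !mul0r addr0.
Qed.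

(** A row meets a single class, where the column is a multiple of [x]; if [x]
    violates the row there, the norm of the class is 0. *)
Lemma proj_cycle b : (b < n)%N -> cycle (proj lab x norm ^~ b).
Proof.
move=> bn i fi; have /andP[iN _] := fi.
apply/eqP; apply: contraT => ne; have c1n := row_dot_neq0 iN ne.
move: ne; suff -> : row_dot i (proj lab x norm ^~ b) =
    if lab (c1 i) == lab b then row_dot i x * x b / norm (lab b) else 0.
  case: (lab (c1 i) =P lab b) => [e|_]; last by rewrite eqxx.
  have [[nb _]|[_ ->]] := normP bn; last by rewrite invr0 mulr0 eqxx.
  by have := nb i; rewrite /bad fi e eqxx andbT negbK => /eqP->; rewrite !mul0r eqxx.
rewrite /row_dot /proj; have [->|v20] := eqVneq (v2 i) 0.
  by rewrite !mul0r !addr0; case: eqP => [->|]; rewrite ?mulr0 // !mulrA.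
rewrite -(lab_edge fi v20); case: eqP => [->|]; last by rewrite !mulr0 addr0.
by rewrite !mulrA -!mulrDl.
Qed.

(** A class with a violated equation carries no nonzero cycle. *)
Lemma bad_class u b i : (b < n)%N -> cycle u -> bad lab x i (lab b) -> u b = 0.
Proof.
move=> bn cu /and3P[fi ne /eqP li]; have /andP[iN _] := fi.
have [h1 h2 h12] := slots iN; have c1n := row_dot_neq0 iN ne.
have [_ _ _ ->//] := lab_spans bn; have [_ _ _ u1] := lab_spans c1n.
have := cu _ fi; rewrite (_ : row_dot i u = row_dot i x * u (lab b).-1).
  by move/eqP; rewrite mulf_eq0 (negPf ne) => /eqP->; rewrite mulr0.
rewrite /row_dot u1 // li; have [->|v20] := eqVneq (v2 i) 0.
  by rewrite !mul0r !addr0 mulrA.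
have [_ _ _ ->//] := lab_spans (h2 v20).
by rewrite -(lab_edge fi v20) li; ring.
Qed.

Lemma sqnorm_gt0 b : (b < n)%N -> 0 < sqnorm lab x (lab b).
Proof.
move=> bn; have [ln ll x1 _] := lab_spans bn; have l0 := lab_gt0 bn.
have rn : ((lab b).-1 < n)%N by rewrite prednK.
rewrite /sqnorm (bigD1 (Ordinal rn)) /= ?ll // x1 expr1n mul1r ltr_wpDr //.
  by apply: sumr_ge0 => a _; rewrite divr_ge0 ?sqr_ge0 // ltW // wt0.
by rewrite invr_gt0 wt0.
Qed.

(** Both sides equal the coordinate at the root times [x b]: along a class [u] is
    a multiple of [x], and the squared norm cancels. *)
Lemma proj_dot u b : (b < n)%N -> cycle u ->
  \sum_(a < n) u a * proj lab x norm a b / wt a = u b.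
Proof.
move=> bn cu; have [[_ nE]|[[i bi] n0]] := normP bn; last first.
  rewrite (bad_class bn cu bi) big1 // => a _; rewrite /proj.
  by case: eqP => [->|_]; rewrite ?n0 ?invr0 !(mulr0, mul0r).
have [_ _ _ ->//] := lab_spans bn; set r := lab b.
have -> : \sum_(a < n) u a * proj lab x norm a b / wt a =
    \sum_(a < n | lab a == r) x a ^+ 2 / wt a * (u r.-1 * x b / norm r).
  rewrite [RHS]big_mkcond /=; apply: eq_bigr => a _; rewrite /proj -/r.
  case: eqP => [la|_]; last by rewrite mulr0 mul0r.
  by have [_ _ _ ->//] := lab_spans (ltn_ord a); rewrite la; ring.
rewrite -mulr_suml -/(sqnorm lab x r) nE mulrCA mulfV ?mulr1 1?mulrC //.
by rewrite gt_eqF // sqnorm_gt0.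
Qed.

End Proj.
End TwoSlots.

(** * The program *)

Definition seqs (cs : seq cmd) : cmd := foldr Seq Skip cs.

(** Natural variables 0, 1, 2 are the input sizes, 3 is the counter of the
    current loop. Arrays 0, 1, 2 are the input; array 3 flags the rows of [K]
    among the rows of [L]. *)
Local Notation nI := (NVar 3).

Definition flag_body : cmd := NStore 3 (NGet 2 nI) (NConst 1).

(** Arrays 4 and 5 (of naturals and of reals) hold the at most two entries of
    each row; missing ones read as coefficient 0. *)
Definition slots_body : cmd := seqs
  [:: NAssign 4 (NGet 0 nI);
      NAssign 5 (NSub (NGet 0 (NAdd nI (NConst 1))) (NVar 4));
      If (BNLt (NConst 0) (NVar 5))
        (Seq (NStore 4 nI (NGet 1 (NVar 4))) (RStore 4 nI (RGet 0 (NVar 4))))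
        Skip;
      If (BNLt (NConst 1) (NVar 5))
        (Seq (NStore 5 nI (NGet 1 (NAdd (NVar 4) (NConst 1))))
             (RStore 5 nI (RGet 0 (NAdd (NVar 4) (NConst 1)))))
        Skip].

(** Prepends to the adjacency list of the column in variable [a] a node, numbered
    by variable 4, that leads to the column in variable [b] with the ratio held
    in real variable 0. Arrays 6, 7, 8 are list heads, successors (both shifted
    by one, 0 being the empty list) and targets; real array 6 holds ratios. *)
Definition link (a b : nat) : cmd := seqs
  [:: NStore 7 (NVar 4) (NGet 6 (NVar a));
      NStore 6 (NVar a) (NAdd (NVar 4) (NConst 1));
      NStore 8 (NVar 4) (NVar b);
      RStore 6 (NVar 4) (RVar 0);
      NAssign 4 (NAdd (NVar 4) (NConst 1))].

Definition edges_body : cmd :=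
  If (BAnd (BNLt (NGet 3 nI) (NConst 1))
           (BRLt RZero (RMul (RGet 5 nI) (RGet 5 nI))))
    (seqs [:: NAssign 6 (NGet 4 nI); NAssign 7 (NGet 5 nI);
              RAssign 0 (RDiv (RSub RZero (RGet 4 nI)) (RGet 5 nI)); link 6 7;
              RAssign 0 (RDiv (RSub RZero (RGet 5 nI)) (RGet 4 nI)); link 7 6])
    Skip.

(** Depth-first search: variable 4 counts the roots tried so far, the stack is
    array 10 with its height in variable 5, array 9 holds labels and real array
    7 coordinates relative to the root. A list node is consumed when followed. *)
Definition search_test : bexpr :=
  BNot (BAnd (BNot (BNLt (NVar 4) (NVar 1))) (BNot (BNLt (NConst 0) (NVar 5)))).

Definition search_body : cmd :=
  If (BNLt (NConst 0) (NVar 5))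
    (seqs [:: NAssign 6 (NGet 10 (NSub (NVar 5) (NConst 1)));
              NAssign 7 (NGet 6 (NVar 6));
              If (BNLt (NConst 0) (NVar 7))
                (seqs [:: NAssign 7 (NSub (NVar 7) (NConst 1));
                          NStore 6 (NVar 6) (NGet 7 (NVar 7));
                          NAssign 8 (NGet 8 (NVar 7));
                          If (BNLt (NGet 9 (NVar 8)) (NConst 1))
                            (seqs [:: NStore 9 (NVar 8) (NVar 4);
                                      RStore 7 (NVar 8)
                                        (RMul (RGet 7 (NVar 6)) (RGet 6 (NVar 7)));
                                      NStore 10 (NVar 5) (NVar 8);
                                      NAssign 5 (NAdd (NVar 5) (NConst 1))])
                            Skip])
                (NAssign 5 (NSub (NVar 5) (NConst 1)))])
    (seqs [:: NAssign 6 (NVar 4);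
              NAssign 4 (NAdd (NVar 4) (NConst 1));
              If (BNLt (NGet 9 (NVar 6)) (NConst 1))
                (seqs [:: NStore 9 (NVar 6) (NVar 4); RStore 7 (NVar 6) ROne;
                          NStore 10 (NConst 0) (NVar 6); NAssign 5 (NConst 1)])
                Skip]).

Definition norm_body : cmd :=
  RStore 8 (NGet 9 nI)
    (RAdd (RGet 8 (NGet 9 nI))
          (RDiv (RMul (RGet 7 nI) (RGet 7 nI)) (RGet 1 nI))).

Definition kill_body : cmd :=
  If (BNLt (NGet 3 nI) (NConst 1))
    (seqs [:: RAssign 0 (RAdd (RMul (RGet 4 nI) (RGet 7 (NGet 4 nI)))
                              (RMul (RGet 5 nI) (RGet 7 (NGet 5 nI))));
              If (BRLt RZero (RMul (RVar 0) (RVar 0)))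
                (RStore 8 (NGet 9 (NGet 4 nI)) RZero) Skip])
    Skip.

(** Adds the contribution of one entry of the row in variable 6 and one entry of
    the row in variable 7; [a] and [b] select the entries. *)
Definition pair_term (a b : nat) : cmd := seqs
  [:: NAssign 8 (NGet 9 (NGet a (NVar 6)));
      NAssign 9 (NGet 9 (NGet b (NVar 7)));
      If (BAnd (BNot (BNLt (NVar 8) (NVar 9))) (BNot (BNLt (NVar 9) (NVar 8))))
        (RAssign 0
           (RAdd (RVar 0)
              (RMul (RMul (RGet a (NVar 6))
                          (RDiv (RMul (RGet 7 (NGet a (NVar 6)))
                                      (RGet 7 (NGet b (NVar 7))))
                                (RGet 8 (NVar 8))))
                    (RGet b (NVar 7)))))
        Skip].

(** Variables 3 and 4 are the row and the column of the output entry, variable 5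
    is its address, so that no product of naturals is needed. *)
Definition entry_body : cmd := seqs
  [:: NAssign 6 (NGet 2 nI); NAssign 7 (NGet 2 (NVar 4)); RAssign 0 RZero;
      pair_term 4 4; pair_term 4 5; pair_term 5 4; pair_term 5 5;
      RStore 3 (NVar 5) (RDiv (RVar 0) (RGet 2 (NVar 4)));
      NAssign 5 (NAdd (NVar 5) (NConst 1));
      NAssign 4 (NAdd (NVar 4) (NConst 1));
      If (BNLt (NVar 4) (NVar 2)) Skip
        (Seq (NAssign 4 (NConst 0)) (NAssign 3 (NAdd nI (NConst 1))))].

Definition search : cmd := seqs
  [:: NAssign 4 (NConst 0); NAssign 5 (NConst 0); While search_test search_body].

Definition entries : cmd := seqs
  [:: NAssign 3 (NConst 0); NAssign 4 (NConst 0); NAssign 5 (NConst 0);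
      While (BNLt nI (NVar 2)) entry_body].

Definition edges : cmd := Seq (NAssign 4 (NConst 0)) (For 3 0 edges_body).

Definition laplacian_program : cmd :=
  Seq (For 3 2 flag_body)
  (Seq (For 3 0 slots_body)
  (Seq edges
  (Seq search
  (Seq (For 3 1 norm_body)
  (Seq (For 3 0 kill_body) entries))))).

(** * Correctness of the passes *)

Section Passes.
Context (R : realType).
Implicit Types (s t : state R).

Lemma flag_correct s :
  (forall r, narr s 3 r = 0%N) ->
  computes (For 3 2 flag_body) s (for_cost flag_body (nvar s 2))
    (fun t => forall r,
       (narr t 3 r != 0%N) = (r \in [seq narr s 2 k | k <- iota 0 (nvar s 2)])).
Proof.
move=> z; apply: (computes_for (I := fun i t => forall r,
  (narr t 3 r != 0%N) = (r \in [seq narr s 2 k | k <- iota 0 i]))) => //.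
  by move=> r; rewrite /= z.
move=> i t _ [_ fr _] ti It j v -> -> r.
rewrite -[i.+1]addn1 iotaD map_cat mem_cat -It /=.
rewrite /upd2 /upd /= ti fr // inE add0n.
by case: (r =P _) => [->|_]; rewrite ?orbT ?orbF.
Qed.

(** The entry number [len] of the row [i] that starts at [p i] and has [d i]
    entries, or [z] if the row is too short. *)
Definition slot (len : nat) T (z : T) (p d : nat -> nat) (f : nat -> T) i : T :=
  if (len < d i)%N then f (p i + len)%N else z.

Lemma slots_correct s :
  let p := narr s 0 in let d i := (p i.+1 - p i)%N in
  (forall r, narr s 4 r = 0%N) -> (forall r, narr s 5 r = 0%N) ->
  (forall r, rarr s 4 r = 0) -> (forall r, rarr s 5 r = 0) ->
  computes (For 3 0 slots_body) s (for_cost slots_body (nvar s 0))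
    (fun t => forall i, (i < nvar s 0)%N ->
       [/\ narr t 4 i = slot 0 0%N p d (narr s 1) i,
           narr t 5 i = slot 1 0%N p d (narr s 1) i,
           rarr t 4 i = slot 0 0 p d (rarr s 0) i &
           rarr t 5 i = slot 1 0 p d (rarr s 0) i]).
Proof.
move=> p d n4 n5 r4 r5.
pose I k t := forall i,
  [/\ narr t 4 i = if (i < k)%N then slot 0 0%N p d (narr s 1) i else 0%N,
      narr t 5 i = if (i < k)%N then slot 1 0%N p d (narr s 1) i else 0%N,
      rarr t 4 i = if (i < k)%N then slot 0 0 p d (rarr s 0) i else 0 &
      rarr t 5 i = if (i < k)%N then slot 1 0 p d (rarr s 0) i else 0].
apply: (computes_impl (Q := I (nvar s 0)) _ (leqnn _)) => [|t _ It i iN]; last first.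
  by have := It i; rewrite iN.
apply: computes_for => // [i|]; first by rewrite /= n4 n5 r4 r5.
move=> k t _ [_ fn fr] tk It.
have tp : narr t 0 = p by rewrite fn.
have tc : narr t 1 = narr s 1 by rewrite fn.
have tv : rarr t 0 = rarr s 0 by rewrite fr.
rewrite /slots_body /= => b -> e ->; rewrite /upd2 /upd /= tp addn1 tk -/(d k).
case: ifP => d0; [move=> ? ? -> -> ? ? -> ->|];
  (case: ifP => d1; [move=> ? ? -> -> ? ? -> ->|]).
all: move=> i; rewrite /= /upd2 /upd /= ?tc ?tv ltnS leq_eqVlt.
all: case: (i =P k) => [->|_] /=; last exact: It.
all: have := It k; rewrite ltnn => -[h4 h5 h6 h7].
all: by rewrite /slot ?h4 ?h5 ?h6 ?h7 d0 d1 ?addn0.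
Qed.


(** ** Linked adjacency lists *)

Lemma updE T (f : nat -> T) i v j : upd f i v j = if j == i then v else f j.
Proof. by []. Qed.

Lemma upd_same T (f : nat -> T) i v : upd f i v i = v.
Proof. by rewrite updE eqxx. Qed.

Lemma upd_other T (f : nat -> T) i v j : j != i -> upd f i v j = f j.
Proof. by rewrite updE => /negPf->. Qed.

Lemma sum_upd n T (F : T -> nat) (g : nat -> T) b v : (b < n)%N ->
  (\sum_(a < n) F (upd g b v a) + F (g b) = \sum_(a < n) F (g a) + F v)%N.
Proof.
move=> bn; rewrite (bigD1 (Ordinal bn)) //= upd_same.
rewrite [in RHS](bigD1 (Ordinal bn)) //=.
rewrite (eq_bigr (fun a : 'I_n => F (g a))) => [|a ab]; first by lia.
by rewrite upd_other //; apply: contra ab => /eqP ab; apply/eqP/val_inj.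
Qed.

(** Links are shifted by one: [e.+1] points to the node [e] and 0 ends the list. *)
Fixpoint linked (nxt : nat -> nat) (h : nat) (l : seq nat) : Prop :=
  if l is e :: l' then h = e.+1 /\ linked nxt (nxt e) l' else h = 0%N.

Lemma linked_upd nxt m v h l :
  m \notin l -> linked nxt h l -> linked (upd nxt m v) h l.
Proof.
elim: l h => //= e l IH h; rewrite inE negb_or eq_sym => /andP[em ml] [-> lk].
by split=> //; rewrite upd_other //; apply: IH.
Qed.

Section Graph.
Context (nr n : nat) (inK : nat -> bool).
Context (c1 c2 : nat -> nat) (v1 v2 : nat -> R).
Implicit Types (adj rem : nat -> seq nat) (head nxt tgt lab stk : nat -> nat).
Implicit Types (rat x : nat -> R).

Let cycle := cycle nr inK c1 c2 v1 v2.
Let free := free_row nr inK.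
Hypothesis slots : slots_ok nr n c1 c2 v1 v2.

Definition arrow a b (rho : R) : Prop :=
  (b < n)%N /\ forall u, cycle u -> u b = rho * u a.

(** Nodes are numbered from 0 to [m - 1], so the list [adj a] does not contain the
    number [m] given to the next one. *)
Definition graph adj head nxt tgt rat m : Prop :=
  forall a, (a < n)%N ->
    linked nxt (head a) (adj a) /\
    forall e, e \in adj a -> (e < m)%N /\ arrow a (tgt e) (rat e).

Definition joined adj tgt a b : Prop := exists2 e, e \in adj a & tgt e = b.

Lemma graph_push adj head nxt tgt rat m a b rho :
  graph adj head nxt tgt rat m -> arrow a b rho ->
  graph (upd adj a (m :: adj a)) (upd head a m.+1) (upd nxt m (head a))
    (upd tgt m b) (upd rat m rho) m.+1.
Proof.
move=> G ab a' a'n; have [lk old] := G a' a'n.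
have fresh l : {subset l <= adj a'} -> m \notin l.
  by move=> sub; apply/negP => /sub /old[]; rewrite ltnn.
have old' e : e \in adj a' ->
    (e < m.+1)%N /\ arrow a' (upd tgt m b e) (upd rat m rho e).
  move=> /old[em ar]; rewrite !upd_other ?(ltn_eqF em) //.
  by split=> //; apply: ltnW.
have [e|ne] := eqVneq a' a; last first.
  by rewrite !upd_other //; split=> //; apply: linked_upd => //; apply: fresh.
rewrite e !upd_same in lk old' fresh *; split.
  by split=> //; rewrite upd_same; apply: linked_upd => //; apply: fresh.
by move=> f; rewrite inE => /predU1P[->|/old'//]; rewrite !upd_same.
Qed.

Lemma joined_push adj head nxt tgt rat m a b a' b' : (a' < n)%N ->
  graph adj head nxt tgt rat m -> joined adj tgt a' b' ->
  joined (upd adj a (m :: adj a)) (upd tgt m b) a' b'.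
Proof.
move=> a'n G [e ea eb]; exists e; last first.
  by have [_ /(_ e ea)[em _]] := G _ a'n; rewrite upd_other // ltn_eqF.
by rewrite updE; case: eqP => // aa; rewrite inE -aa ea orbT.
Qed.

Lemma joined_new adj tgt m a b :
  joined (upd adj a (m :: adj a)) (upd tgt m b) a b.
Proof. by exists m; rewrite upd_same ?mem_head. Qed.

Lemma size_push n' adj m a : (a < n')%N ->
  (\sum_(a' < n') size (upd adj a (m :: adj a) a') =
   (\sum_(a' < n') size (adj a')).+1)%N.
Proof. by move=> an; have := sum_upd size adj (m :: adj a) an; rewrite /=; lia. Qed.

(** Storing both directions of a relation lets the search compare the labels of its
    two ends in either order. *)
Definition complete adj tgt k : Prop :=
  forall i, (i < k)%N -> free i -> v2 i != 0 ->
    joined adj tgt (c1 i) (c2 i) /\ joined adj tgt (c2 i) (c1 i).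

Lemma edges_correct s :
  nvar s 0 = nr -> (forall r, inK r = (narr s 3 r != 0%N)) ->
  narr s 4 = c1 -> narr s 5 = c2 -> rarr s 4 = v1 -> rarr s 5 = v2 ->
  (forall a, narr s 6 a = 0%N) ->
  computes edges s (2 + for_cost edges_body nr) (fun t => exists adj m,
    [/\ graph adj (narr t 6) (narr t 7) (narr t 8) (rarr t 6) m,
        (\sum_(a < n) size (adj a) <= 2 * nr)%N & complete adj (narr t 8) nr]).
Proof.
move=> s0 s3 s4 s5 s6 s7 h0.
apply: (computes_seq (Q1 := fun t => t = set_nvar s 4 0%N)).
  exact: (computes_run (c := NAssign 4 (NConst 0))).
move=> _ _ ->; pose I k t := exists adj,
    [/\ graph adj (narr t 6) (narr t 7) (narr t 8) (rarr t 6) (nvar t 4),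
        (\sum_(a < n) size (adj a) <= 2 * k)%N & complete adj (narr t 8) k].
apply: (computes_impl (Q := I nr) _ (leqnn _)) => [|t _ [adj [G S C]]]; last first.
  by exists adj, (nvar t 4).
apply: computes_for => //.
  exists (fun=> [::]); split=> [a an||//]; first by split=> //=.
  by rewrite big1.
move=> k t kn [_ fn fr] tk [adj [G S C]].
have t3 : narr t 3 = narr s 3 by rewrite fn.
have t4 : narr t 4 = c1 by rewrite fn.
have t5 : narr t 5 = c2 by rewrite fn.
have t6 : rarr t 4 = v1 by rewrite fr.
have t7 : rarr t 5 = v2 by rewrite fr.
have tE : (if beval t (BAnd (BNLt (NGet 3 nI) (NConst 1))
           (BRLt RZero (RMul (RGet 5 nI) (RGet 5 nI)))) then true else false)
         = free k && (v2 k != 0).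
  rewrite /= tk t3 t7 /free /free_row kn /= s3 negbK ltnS leqn0 -expr2.
  by rewrite lt_neqAle sqr_ge0 andbT [0 == _]eq_sym sqrf_eq0; case: ifP.
rewrite /edges_body /link; cbn -[beval]; move: tE; case: ifP => _ /esym.
- move=> /andP[fk v2k].
  have [h1 h2 h12] := slots kn; have v1k := h12 v2k.
  have ar1 : arrow (c1 k) (c2 k) (- v1 k / v2 k).
    split=> [|u /(_ k fk) e]; first exact: h2.
    apply: (mulfI v2k); transitivity (- (v1 k * u (c1 k))); last by field.
    by apply/eqP; rewrite -addr_eq0 addrC; apply/eqP.
  have ar2 : arrow (c2 k) (c1 k) (- v2 k / v1 k).
    split=> [|u /(_ k fk) e]; first exact: h1.
    apply: (mulfI v1k); transitivity (- (v2 k * u (c2 k))); last by field.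
    by apply/eqP; rewrite -addr_eq0; apply/eqP.
  rewrite tk t4 t5 t6 t7 !sub0r => ? -> ? -> ? ->.
  move=> ? ? -> -> ? ? -> -> ? ? -> -> ? ? -> -> ? -> ? ->.
  move=> ? ? -> -> ? ? -> -> ? ? -> -> ? ? -> -> ? ->; rewrite !addn1.
  pose adj1 := upd adj (c1 k) (nvar t 4 :: adj (c1 k)).
  have G1 := graph_push G ar1; have G2 := graph_push G1 ar2.
  exists (upd adj1 (c2 k) ((nvar t 4).+1 :: adj1 (c2 k))).
  split; first exact: G2.
    by rewrite !size_push ?h1 ?h2 //; lia.
  move=> i; rewrite ltnS leq_eqVlt => /predU1P[->|ik] fi v2i.
    split; last exact: joined_new.
    by apply: joined_push G1 _; [exact: h1|exact: joined_new].
  have /andP[iN _] := fi; have [h1' h2' h12'] := slots iN.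
  have [j1 j2] := C i ik fi v2i.
  by split; (apply: joined_push G1 _; last apply: joined_push G _ => //);
    rewrite ?h1' ?h2' // h12'.
- move=> nfk; exists adj; split=> //=; first by apply: leq_trans S _; lia.
  move=> i; rewrite ltnS leq_eqVlt => /predU1P[->|ik] fi v2i; last exact: C.
  by rewrite fi v2i in nfk.
Qed.


(** ** Depth-first search *)

(** [lia] needs the big sums of the goal replaced by variables. *)
Ltac lia_sums := repeat match goal with
  |- context [bigop.body ?i ?r ?f] => move: (bigop.body i r f) => ? end; lia.

Section Search.
Context (adj : nat -> seq nat) (nxt tgt : nat -> nat) (rat : nat -> R).

(** Labels grow with time, so a processed edge satisfies only the inequality
    [inv_done]. The two directions of an edge then force equality, and nothing
    has to be said about the order in which columns are closed. *)
Record search_inv r sp head lab stk x rem : Prop := {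
  inv_root_le : (r <= n)%N;
  inv_linked : forall a, (a < n)%N -> linked nxt (head a) (rem a);
  inv_arrow : forall a e, (a < n)%N -> e \in rem a -> arrow a (tgt e) (rat e);
  inv_fresh : forall a, (a < n)%N -> lab a = 0%N -> rem a = adj a;
  inv_done : forall a e, (a < n)%N -> (0 < lab a)%N -> e \in adj a ->
    e \in rem a \/ (0 < lab (tgt e) <= lab a)%N;
  inv_open : forall a, (a < n)%N -> (0 < lab a)%N ->
    rem a = [::] \/ exists2 p, (p < sp)%N & stk p = a;
  inv_stack : forall p, (p < sp)%N ->
    [/\ (stk p < n)%N, lab (stk p) = r & (0 < r)%N];
  inv_label_le : forall a, (a < n)%N -> (lab a <= r)%N;
  inv_tried : forall a, (a < r)%N -> (0 < lab a)%N;
  inv_spanned : forall a, (a < n)%N -> (0 < lab a)%N ->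
    spanned nr n inK c1 c2 v1 v2 lab x a }.

Lemma search_pop r sp head lab stk x rem :
  search_inv r sp.+1 head lab stk x rem -> rem (stk sp) = [::] ->
  search_inv r sp head lab stk x rem.
Proof.
case=> rn lk ar fresh dn op st le tr span e0; split=> //.
- move=> a an la; have [->|[p]] := op a an la; first by left.
  by rewrite ltnS leq_eqVlt => /predU1P[->|ps] <-; [left | right; exists p].
- by move=> p /ltnW; apply: st.
Qed.

Lemma search_follow r sp head lab stk x rem a e l :
  search_inv r sp head lab stk x rem -> (a < n)%N -> lab a = r ->
  rem a = e :: l -> (0 < lab (tgt e))%N ->
  search_inv r sp (upd head a (nxt e)) lab stk x (upd rem a l).
Proof.
case=> rn lk ar fresh dn op st le tr span an la re lt.
have ten : (tgt e < n)%N by have [] := ar a e an; rewrite // re mem_head.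
have r0 : (0 < r)%N by apply: leq_trans lt (le _ ten).
split=> // b.
- move=> bn; rewrite !updE; case: eqP => [_|_]; last exact: lk.
  by have := lk a an; rewrite re => -[].
- move=> f bn; rewrite updE; case: eqP => [->|_] fl; last exact: ar.
  by apply: ar => //; rewrite re inE fl orbT.
- move=> bn lb; rewrite updE; case: eqP => [ba|_]; last exact: fresh.
  by rewrite ba la in lb; rewrite lb in r0.
- move=> f bn lb fa; have := dn b f bn lb fa; rewrite updE; case: eqP => // ba.
  rewrite ba re inE => -[/predU1P[->|]|]; [right|by left|by right].
  by rewrite lt la le.
- move=> bn lb; have := op b bn lb; rewrite updE; case: eqP => // ->.
  by rewrite re => -[//|]; right.
Qed.

(** This serves both for a column reached from the top of the stack ([r' = r]) and
    for a new root, which is tried only on the empty stack. *)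
Lemma search_visit r r' sp head lab stk x rem b y :
  search_inv r sp head lab stk x rem -> (b < n)%N -> lab b = 0%N ->
  (sp = 0%N \/ r' = r) -> (r <= r')%N -> (0 < r' <= n)%N ->
  (forall a, (a < r')%N -> a = b \/ (0 < lab a)%N) ->
  upd lab b r' r'.-1 = r' -> upd x b y r'.-1 = 1 ->
  (forall u, cycle u -> u b = y * u r'.-1) ->
  search_inv r' sp.+1 head (upd lab b r') (upd stk sp b) (upd x b y) rem.
Proof.
case=> rn lk ar fresh dn op st le tr span bn lb0 spr rr' /andP[r'0 r'n] tr' lr xr ub.
have labb a : (0 < lab a)%N -> upd lab b r' a = lab a.
  by move=> la; rewrite updE; case: eqP => // ab; rewrite ab lb0 in la.
split=> //.
- by move=> a an; rewrite updE; case: eqP => [_|_]; [lia | exact: fresh].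
- move=> a e an; rewrite [upd lab b r' a]updE; case: eqP => [->|_] la ea.
    by left; rewrite fresh.
  have [|/andP[t0 tle]] := dn a e an la ea; first by left.
  by right; rewrite labb // t0.
- move=> a an; rewrite updE; case: eqP => [->|_] la.
    by right; exists sp; rewrite ?upd_same.
  have [|[p ps pa]] := op a an la; [by left | right].
  by exists p; [exact: leqW | rewrite upd_other // ltn_eqF].
- move=> p; rewrite ltnS leq_eqVlt => /predU1P[->|ps].
    by rewrite !upd_same.
  rewrite [upd stk sp b p]upd_other ?ltn_eqF //; have [s1 s2 s3] := st p ps.
  case: spr => [sp0|e]; first by rewrite sp0 in ps.
  by rewrite labb ?s2 ?e.
- move=> a an; rewrite updE; case: eqP => // _; exact: leq_trans (le a an) rr'.
- by move=> a ar'; rewrite updE; case: eqP => // ab; case: (tr' a ar').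
- move=> a an; rewrite /spanned [upd lab b r' a]updE; case: eqP => [->|ab] la.
    by split=> // u cu; rewrite upd_same; apply: ub.
  have [s1 s2 s3 s4] := span a an la.
  have rb : (lab a).-1 != b by apply: contraTneq la => rb; rewrite -s2 rb lb0.
  by split; rewrite ?labb ?s2 //;
    [rewrite upd_other | rewrite upd_other //; apply/eqP].
Qed.

Lemma search_skip r head lab stk x rem :
  search_inv r 0 head lab stk x rem -> (r < n)%N -> (0 < lab r)%N ->
  search_inv r.+1 0 head lab stk x rem.
Proof.
case=> rn lk ar fresh dn op st le tr span r1n lr; split=> //.
- by move=> a an; apply: leqW; apply: le.
- by move=> a; rewrite ltnS leq_eqVlt => /predU1P[->|/tr].
Qed.

Lemma search_root r head lab stk x rem :
  search_inv r 0 head lab stk x rem -> (r < n)%N -> lab r = 0%N ->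
  search_inv r.+1 1 head (upd lab r r.+1) (upd stk 0 r) (upd x r 1) rem.
Proof.
move=> inv rn lr; apply: (search_visit inv) => //; rewrite ?upd_same //.
- by left.
- by move=> a; rewrite ltnS leq_eqVlt => /predU1P[->|/(inv_tried inv)]; [left|right].
- by move=> u _; rewrite mul1r.
Qed.

Lemma search_child r sp head lab stk x rem a e l :
  search_inv r sp head lab stk x rem -> (a < n)%N -> lab a = r -> (0 < r)%N ->
  rem a = e :: l -> lab (tgt e) = 0%N ->
  search_inv r sp.+1 (upd head a (nxt e)) (upd lab (tgt e) r)
    (upd stk sp (tgt e)) (upd x (tgt e) (x a * rat e)) (upd rem a l).
Proof.
move=> inv an la r0 re lt; have [ten arr] : arrow a (tgt e) (rat e).
  by apply: (inv_arrow inv) => //; rewrite re mem_head.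
have ta : a != tgt e by apply: contraTneq r0 => at_; rewrite -la at_ lt.
have [s1 s2 s3 s4] : spanned nr n inK c1 c2 v1 v2 lab x a.
  by apply: (inv_spanned inv); rewrite ?la.
rewrite la in s1 s2 s3 s4.
have tr : r.-1 != tgt e by apply: contraTneq r0 => at_; rewrite -s2 at_ lt.
apply: search_follow; rewrite ?upd_same ?upd_other //.
apply: (search_visit inv) => //; rewrite ?upd_other ?r0 //.
- by right.
- by move=> b /(inv_tried inv); right.
- by move=> u cu; rewrite arr // s4 //; ring.
Qed.

Lemma search_final lab head stk x rem :
  search_inv n 0 head lab stk x rem -> complete adj tgt nr ->
  (forall a, (a < n)%N -> (0 < lab a)%N /\ spanned nr n inK c1 c2 v1 v2 lab x a) /\
  (forall i, free i -> v2 i != 0 -> lab (c1 i) = lab (c2 i)).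
Proof.
move=> inv C; split=> [a an|i fi v2i].
  by split; [|apply: (inv_spanned inv) => //]; apply: (inv_tried inv).
have le a b : (a < n)%N -> joined adj tgt a b -> (lab b <= lab a)%N.
  move=> an [e ea <-]; have la := inv_tried inv an.
  have [|/andP[]//] := inv_done inv an la ea.
  by have [->|[]//] := inv_open inv an la.
have /andP[iN _] := fi; have [j1 j2] := C i iN fi v2i.
have [h1 h2 h12] := slots iN.
by apply/eqP; rewrite eqn_leq !le // ?h1 ?h2 // h12.
Qed.

End Search.

Definition search_cost (k : nat) : nat :=
  (4 + (k * (bcost search_test + maxcost search_body).+1 +
        (bcost search_test).+1))%N.

(** Every iteration tries a root, pops a column or consumes a list node. Pushing a
    column is paid for by that column no longer being unlabelled, so the number of
    iterations is at most twice the number of columns plus the number of nodes. *)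
Lemma search_correct s adj m : nvar s 1 = n ->
  (forall a, narr s 9 a = 0%N) ->
  graph adj (narr s 6) (narr s 7) (narr s 8) (rarr s 6) m ->
  (\sum_(a < n) size (adj a) <= 2 * nr)%N -> complete adj (narr s 8) nr ->
  computes search s (search_cost (2 * n + 2 * nr))
    (fun t => let lab := narr t 9 in let x := rarr t 7 in
     (forall a, (a < n)%N ->
        (0 < lab a)%N /\ spanned nr n inK c1 c2 v1 v2 lab x a) /\
     (forall i, free i -> v2 i != 0 -> lab (c1 i) = lab (c2 i))).
Proof.
move=> s1 s9 G S C; set nxt := narr s 7 in G; set tgt := narr s 8 in G C.
set rat := rarr s 6 in G.
pose measure r sp lab rem :=
  ((n - r) + sp + \sum_(a < n) (lab a == 0) + \sum_(a < n) size (rem a))%N.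
pose I k t := exists2 rem,
  search_inv adj nxt tgt rat (nvar t 4) (nvar t 5) (narr t 6) (narr t 9)
    (narr t 10) (rarr t 7) rem &
  (measure (nvar t 4) (nvar t 5) (narr t 9) rem <= k)%N.
set s' := set_nvar (set_nvar s 4 0%N) 5 0%N.
apply: (computes_impl (B := 2 + (2 + (((2 * n + 2 * nr) *
  (bcost search_test + maxcost search_body).+1 + (bcost search_test).+1) + 0)))
  (Q := fun t => ~~ beval t search_test /\ (exists k, I k t) /\ nvar t 1 = n)).
- apply: (computes_seq (Q1 := fun t => t = set_nvar s 4 0%N)).
    exact: (computes_run (c := NAssign 4 (NConst 0))).
  move=> _ _ ->; apply: (computes_seq (Q1 := fun t => t = s')).
    exact: (computes_run (c := NAssign 5 (NConst 0))).
  move=> _ _ ->; apply: (computes_seq (Q1 := fun t =>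
    ~~ beval t search_test /\ (exists k, I k t) /\ nvar t 1 = n)); last first.
    by move=> t _ q; apply: (computes_run (c := Skip)).
  apply: (computes_impl (Q := fun t => ~~ beval t search_test /\ exists k, I k t)
    _ (leqnn _)); last first.
    by move=> t [fn _ _] [h1 h2]; split=> //; split=> //; rewrite fn.
  apply: (computes_while (I := I)) => //.
    exists adj; last first.
      rewrite /measure /s' /= /upd /= (eq_bigr (fun=> 1%N)) => [|a _].
        by rewrite sum1_card card_ord; move: S; set sum := bigop.body _ _ _; lia.
      by rewrite s9.
    split=> //= [a an|a e an ea|a e an|a an|a an|a an]; rewrite ?s9 //.
    + by have [] := G a an.
    + by have [_ /(_ e ea)[]] := G a an.
  move=> k t [fv fn fr] [rem inv le]; rewrite /search_test => bt.
  have t1 : nvar t 1 = n by rewrite fv.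
  have t7 : narr t 7 = nxt by rewrite fn.
  have t8 : narr t 8 = tgt by rewrite fn.
  have t6 : rarr t 6 = rat by rewrite fr.
  have unlabel b l : (b < n)%N -> narr t 9 b = 0%N -> (0 < l)%N ->
      (\sum_(a < n) (narr t 9 a == 0) =
       (\sum_(a < n) (upd (narr t 9) b l a == 0)).+1)%N.
    move=> bn lb l0; have := sum_upd (fun i => (i == 0 : nat)) (narr t 9) l bn.
    by rewrite /= lb (gtn_eqF l0) addn0 addn1 => ->.
  have consume a e l : (a < n)%N -> rem a = e :: l ->
      (\sum_(a < n) size (rem a) = (\sum_(b < n) size (upd rem a l b)).+1)%N.
    by move=> an re; have := sum_upd size rem l an; rewrite re /=; lia.
  case: k le => [|k] le.
    by move: le bt; rewrite /measure /= t1; lia_sums.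
  rewrite /search_body; cbn -[beval leq]; rewrite [beval _ _]/=.
  case: ifP => sp0.
    move=> a aE h hE.
    have {sp0} [sp spE] : exists sp, nvar t 5 = sp.+1.
      by case: (nvar t 5) sp0 => // sp _; exists sp.
    rewrite spE subn1 /= in aE; rewrite spE in inv le.
    have [] := inv_stack inv (leqnn _); rewrite -aE => an la r0.
    have := inv_linked inv an; rewrite -hE [beval _ _]/= {1}/upd /=.
    case re: (rem a) => [|e l] /= => [->|[-> _]] /=.
      move=> v; rewrite /upd /= spE subn1 /= => ->; exists k => //.
      exists rem; first by apply: search_pop inv _; rewrite -aE.
      change (measure (nvar t 4) sp (narr t 9) rem <= k)%N.
      by move: le; rewrite /measure; lia_sums.
    move=> ? ->; rewrite subn1 /= t7 => ? ? -> ->; rewrite t8 => ? ->.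
    have ten : (tgt e < n)%N 
      by have [] := inv_arrow inv an (_ : e \in rem a); rewrite // re mem_head.
    have E := consume a e l an re.
    rewrite -[X in if X then _ else _]/(narr t 9 (tgt e) < 1)%N ltnS leqn0 t6.
    case: ifP => [/eqP lt|/negbT lt].
      move=> ? ? -> -> ? ? -> -> ? ? -> -> ? ->; exists k => //.
      exists (upd rem a l).
        rewrite /= /upd /= spE addn1; exact: search_child.
      change (measure (nvar t 4) (nvar t 5 + 1) (upd (narr t 9) (tgt e) (nvar t 4))
        (upd rem a l) <= k)%N.
      by move: le; rewrite /measure E (unlabel _ _ ten lt r0) spE; lia_sums.
    exists k => //; exists (upd rem a l).
      by rewrite /= /upd /= spE; apply: search_follow; rewrite ?lt0n.
    change (measure (nvar t 4) (nvar t 5) (narr t 9) (upd rem a l) <= k)%N.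
    by move: le; rewrite /measure E spE; lia_sums.
  have rn : (nvar t 4 < n)%N by move: bt; rewrite /= sp0 t1 andbT negbK.
  have sp : nvar t 5 = 0%N by lia.
  rewrite sp in inv le.
  move=> ? -> ? ->; rewrite [beval _ _]/= {1 2}/upd /= addn1 ltnS leqn0.
  case: ifP => [/eqP lr|/negbT lr].
    move=> ? ? -> -> ? ? -> -> ? ? -> -> ? ->; exists k => //.
    exists rem; first exact: search_root.
    change (measure (nvar t 4).+1 1%N (upd (narr t 9) (nvar t 4) (nvar t 4).+1) rem
      <= k)%N.
    move: le; rewrite /measure (unlabel _ _ rn lr (ltn0Sn (nvar t 4))) /=.
    by lia_sums.
  exists k => //.
  exists rem; first by rewrite /= /upd /= sp; apply: search_skip; rewrite ?lt0n.
  rewrite /= /upd /= sp.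
  by move: le; rewrite /measure; lia_sums.
- by rewrite /search_cost; lia.
move=> t _ [nb [[k [rem inv _]] t1]].
move: nb; rewrite /= !negbK -!leqNgt t1 => /andP[nr' sp0].
have [rn sp] : nvar t 4 = n /\ nvar t 5 = 0%N.
  by have := inv_root_le inv; lia.
by rewrite rn sp in inv; apply: search_final inv C.
Qed.

(** ** Norms and output *)

Lemma norm_correct s wt : nvar s 1 = n -> rarr s 1 = wt ->
  (forall r, rarr s 8 r = 0) ->
  computes (For 3 1 norm_body) s (for_cost norm_body n)
    (fun t => forall r, rarr t 8 r = sqnorm n wt (narr s 9) (rarr s 7) r).
Proof.
move=> s1 swt s8; apply: (computes_for (I := fun k t => forall r,
  rarr t 8 r = sqnorm k wt (narr s 9) (rarr s 7) r)) => //.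
  by move=> r; rewrite /= s8 /sqnorm big_ord0.
move=> k t kn [_ fn fr] tk It j v -> -> r.
rewrite /= tk (fn 9) // (fr 7) // (fr 1) // swt.
rewrite /upd2 /upd /= /sqnorm big_mkcond big_ord_recr -big_mkcond /=.
rewrite -/(sqnorm k wt (narr s 9) (rarr s 7) r) eq_sym -expr2.
by case: eqP => [<-|_]; rewrite It // addr0.
Qed.

(** Since a class of norm 0 is discarded by [proj], overwriting the norm removes the
    class as soon as one of its rows is violated. *)
Lemma kill_correct s wt :
  nvar s 0 = nr -> (forall r, inK r = (narr s 3 r != 0%N)) ->
  narr s 4 = c1 -> narr s 5 = c2 -> rarr s 4 = v1 -> rarr s 5 = v2 ->
  let lab := narr s 9 in let x := rarr s 7 in
  (forall r, rarr s 8 r = sqnorm n wt lab x r) ->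
  computes (For 3 0 kill_body) s (for_cost kill_body nr)
    (fun t => forall r, norm_ok nr n inK c1 c2 v1 v2 wt lab x (rarr t 8) r).
Proof.
move=> s0 s3 s4 s5 s6 s7 lab x s8; set B := bad nr inK c1 c2 v1 v2 lab x.
pose I k t := forall r,
  (forall i, (i < k)%N -> ~~ B i r) /\ rarr t 8 r = sqnorm n wt lab x r \/
  (exists2 i, (i < k)%N & B i r) /\ rarr t 8 r = 0.
apply: (computes_impl (Q := I nr) _ (leqnn _)) => [|t _ It r]; last first.
  have [[nb nE]|[[i _ bi] nE]] := It r; [left|right]; split=> //; last by exists i.
  by move=> i; have [/nb//|ni] := ltnP i nr; rewrite /bad /free_row ltnNge ni.
apply: computes_for => // [r|]; first by left; split=> //; apply: s8.
move=> k t kn [_ fn fr] tk It.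
have BE r : B k r = [&& ~~ inK k, row_dot c1 c2 v1 v2 k x != 0 & lab (c1 k) == r].
  by rewrite /B /bad /free_row kn.
have keep : (forall r, ~~ B k r) -> I k.+1 (set_nvar t 3 k.+1).
  move=> nb r; have [[nb' nE]|[[i ik bi] nE]] := It r; [left|right]; split=> //.
    by move=> i; rewrite ltnS leq_eqVlt => /predU1P[->//|/nb'].
  by exists i => //; apply: leqW.
rewrite /kill_body; cbn -[beval]; rewrite [beval _ _]/= tk !fn // ltnS leqn0.
have := s3 k; case: eqP => /= [_ nK|_ kK]; last first.
  by apply: keep => r; rewrite BE kK.
move=> v; rewrite !fr // s4 s5 s6 s7 -/x => vE.
rewrite -[X in if X then _ else _]/(0 < v * v).
have {}vE : v = row_dot c1 c2 v1 v2 k x by [].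
rewrite lt_neqAle -expr2 sqr_ge0 andbT eq_sym sqrf_eq0 vE.
case: eqP => [e|/eqP ne] /=.
  by move=> r; apply: keep => r'; rewrite BE e eqxx andbF.
move=> j w; rewrite -/lab => jE -> r.
rewrite /= /upd2 /upd /= jE; case: eqP => [->|/eqP rl].
  by right; split=> //; exists k => //; rewrite BE nK ne eqxx.
have [[nb' nE]|[[i ik bi] nE]] := It r; [left|right]; split=> //.
  move=> i; rewrite ltnS leq_eqVlt => /predU1P[->|/nb'//].
  by rewrite BE [_ == r]eq_sym (negPf rl) !andbF.
by exists i => //; apply: leqW.
Qed.

End Graph.

Lemma wp_seqs c cs (Q : state R -> Prop) s :
  wp (seqs (c :: cs)) Q s = wp c (wp (seqs cs) Q) s.
Proof. by []. Qed.

Lemma pair_termP a b (Q : state R -> Prop) s :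
  (forall s', (forall x, x \notin [:: 8; 9] -> nvar s' x = nvar s x) ->
     narr s' = narr s -> rarr s' = rarr s ->
     rvar s' 0 = rvar s 0 + rarr s a (nvar s 6) *
       proj (narr s 9) (rarr s 7) (rarr s 8)
         (narr s a (nvar s 6)) (narr s b (nvar s 7)) * rarr s b (nvar s 7) ->
     Q s') ->
  wp (pair_term a b) Q s.
Proof.
move=> h; rewrite /pair_term; cbn -[beval] => v -> w ->.
have frame v1 v2 x : x \notin [:: 8; 9] ->
    upd (upd (nvar s) 8 v1) 9 v2 x = nvar s x.
  by rewrite !inE negb_or => /andP[x8 x9]; rewrite !upd_other.
set l1 := narr s 9 _; set l2 := narr s 9 _.
have lE : (~~ (l1 < l2)%N && ~~ (l2 < l1)%N) = (l1 == l2).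
  by rewrite -!leqNgt andbC eqn_leq.
rewrite -[X in if X then _ else _]/(~~ (l1 < l2)%N && ~~ (l2 < l1)%N) lE.
case: ifP => ll => [u|]; [move=> -> |]; apply: h => //=; try exact: frame.
  by rewrite /proj ll.
by rewrite /proj ll mulr0 mul0r addr0.
Qed.

(** The bilinear form of [P] on the rows [r1] and [r2], in the order in which it is
    accumulated. *)
Definition entry (c1 c2 : nat -> nat) (v1 v2 : nat -> R) (P : nat -> nat -> R)
    r1 r2 : R :=
  0 + v1 r1 * P (c1 r1) (c1 r2) * v1 r2 + v1 r1 * P (c1 r1) (c2 r2) * v2 r2
    + v2 r1 * P (c2 r1) (c1 r2) * v1 r2 + v2 r1 * P (c2 r1) (c2 r2) * v2 r2.

Definition entries_cost (k : nat) : nat :=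
  (k * (3 + maxcost entry_body).+1 + 10)%N.

(** The potential is the number of output cells that are not yet filled. *)
Lemma entries_correct s : let nK := nvar s 2 in
  computes entries s (entries_cost (nK * nK)) (fun t =>
    forall i j, (i < nK)%N -> (j < nK)%N -> rarr t 3 (i * nK + j)%N =
      entry (narr s 4) (narr s 5) (rarr s 4) (rarr s 5)
        (proj (narr s 9) (rarr s 7) (rarr s 8)) (narr s 2 i) (narr s 2 j)
      / rarr s 2 j).
Proof.
move=> nK; pose val i j :=
  entry (narr s 4) (narr s 5) (rarr s 4) (rarr s 5)
    (proj (narr s 9) (rarr s 7) (rarr s 8)) (narr s 2 i) (narr s 2 j) / rarr s 2 j.
pose s' := set_nvar (set_nvar (set_nvar s 3 0%N) 4 0%N) 5 0%N.
pose I k t :=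
  [/\ nvar t 5 = (nvar t 3 * nK + nvar t 4)%N,
      ((nvar t 3 < nK) ==> (nvar t 4 < nK))%N, (nvar t 5 + k = nK * nK)%N &
      forall i j, (j < nK)%N -> (i * nK + j < nvar t 5)%N ->
        rarr t 3 (i * nK + j)%N = val i j].
pose test := BNLt nI (NVar 2).
apply: (computes_impl (B := 2 + (2 + (2 + (((nK * nK) *
  (bcost test + maxcost entry_body).+1 + (bcost test).+1) + 0))))
  (Q := fun t => ~~ beval t test /\ (exists k, I k t) /\ nvar t 2 = nK)).
- apply: (computes_seq (Q1 := fun t => t = set_nvar s 3 0%N)).
    exact: (computes_run (c := NAssign 3 (NConst 0))).
  move=> _ _ ->; apply: (computes_seq (Q1 := fun t =>
    t = set_nvar (set_nvar s 3 0%N) 4 0%N)).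
    exact: (computes_run (c := NAssign 4 (NConst 0))).
  move=> _ _ ->; apply: (computes_seq (Q1 := fun t => t = s')).
    exact: (computes_run (c := NAssign 5 (NConst 0))).
  move=> _ _ ->; apply: (computes_seq (Q1 := fun t =>
    ~~ beval t test /\ (exists k, I k t) /\ nvar t 2 = nK)); last first.
    by move=> t _ q; apply: (computes_run (c := Skip)).
  apply: (computes_impl (Q := fun t => ~~ beval t test /\ exists k, I k t)
    _ (leqnn _)); last first.
    by move=> t [fn _ _] [h1 h2]; split=> //; split=> //; rewrite fn.
  apply: (computes_while (I := I)) => //.
    by split=> //=; apply/implyP.
  move=> k t [fv fn fr] [pE jK pk out] lt; rewrite /= in lt.
  have t2 : nvar t 2 = nK by rewrite fv.
  rewrite t2 in lt; rewrite lt /= in jK.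
  have step c cs Q t' : wp (seqs cs) Q (run c t') -> wp (seqs (c :: cs)) Q t'.
    by rewrite wp_seqs => h; apply/(wpP c).
  rewrite /entry_body; do 3 apply: (step); rewrite [run _ _]/=.
  rewrite wp_seqs; apply: pair_termP => s1 n1 a1 r1 w1.
  rewrite wp_seqs; apply: pair_termP => s2 n2 a2 r2 w2.
  rewrite wp_seqs; apply: pair_termP => s3 n3 a3 r3 w3.
  rewrite wp_seqs; apply: pair_termP => s4 n4 a4 r4 w4.
  have n04 x : x \notin [:: 6; 7; 8; 9] -> nvar s4 x = nvar t x.
    rewrite !inE !negb_or => /and4P[x6 x7 x8 x9].
    rewrite n4 ?n3 ?n2 ?n1 ?inE ?negb_or ?x8 //=.
    by rewrite !upd_other.
  have a04 : narr s4 = narr t by rewrite a4 a3 a2 a1.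
  have r04 : rarr s4 = rarr t by rewrite r4 r3 r2 r1.
  have vE : rvar s4 0 / rarr t 2 (nvar t 4) = val (nvar t 3) (nvar t 4).
    rewrite w4 w3 w2 w1 a3 a2 a1 r3 r2 r1 !(n3, n2, n1) //= /upd /=.
    by rewrite !fn // !(fr 2, fr 4, fr 5, fr 7, fr 8).
  cbn -[beval leq] => ? ? -> ->; rewrite n04 // n04 // r04 vE => ? -> ? ->.
  rewrite n04 // addn1 -[X in if X then _ else _]/(nvar t 4 + 1 < nvar s4 2)%N.
  rewrite n04 // t2.
  have nK0 : (0 < nK)%N by apply: leq_trans lt.
  have out' i j : (j < nK)%N -> (i * nK + j < (nvar t 5).+1)%N ->
      upd (rarr s4 3) (nvar t 5) (val (nvar t 3) (nvar t 4)) (i * nK + j) = val i j.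
    move=> jn; rewrite ltnS leq_eqVlt updE r04.
    case: eqP => /= [e _|_ ep]; last exact: out.
    have ei : i = nvar t 3.
      have := congr1 (divn^~ nK) e; rewrite /= pE.
      by rewrite !divnMDl // !divn_small // !addn0.
    by congr (val _ _); [rewrite ei | move: e; rewrite pE ei => /addnI ->].
  have [k' kE] : exists k', k = k'.+1.
    by case: k pk => [|k'] pk; [nia | exists k'].
  rewrite kE; case: ifP => [jlt|/negbT jge]; last move=> ? -> ? ->; exists k' => //.
    split=> //=; rewrite /upd /= ?n04 //.
    - by rewrite pE addnA addn1.
    - by rewrite jlt implybT.
    - by rewrite -pk kE addnS.
  split=> //=; rewrite /upd /= ?n04 //.
  - by rewrite pE; nia.
  - by rewrite nK0 implybT.
  - by rewrite -pk kE addnS.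
- by rewrite /entries_cost /=; lia.
move=> t _ [nb [[k [pE _ _ out]] t2]] i j iK jK; apply: out => //.
move: nb; rewrite /= t2 -leqNgt pE => le; nia.
Qed.
End Passes.

(** * From the compressed matrix to the Laplacian *)

Section Faces.
Context (R : realType) (V : finType) (L : {set {set V}}) (q : nat).
Context (ori : {set V} -> seq V).
Context (rowL : 'I_(nsimp L q) -> qsimp L q).
Context (colL : 'I_(nsimp L q.+1) -> qsimp L q.+1).
Hypotheses (oriP : orientation L ori) (bijC : bijective colL).
Let M := matrix_in rowL colL (boundary R ori L q).

Lemma boundary_entry_face i j :
  M i j != 0 -> val (rowL i) \subset val (colL j).
Proof.
apply: contraNT => nsub; rewrite mxE lfunE /= /boundary_fun sum_ffunE.
rewrite big1 // => t _; rewrite ffunE [basis_chain _ _ _]ffunE.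
case: (t =P colL j) => [->|_]; last by rewrite [_ *: _]mul0r.
rewrite [_ *: _]mul1r sum_ffunE big1 // => k _; rewrite ffunE [X in _ *: X]ffunE.
case: eqP => [e|_]; last by rewrite [_ *: _]mulr0.
case/negP: nsub; rewrite -e; apply/subsetP => y; rewrite inE /omit.
have /andP[tL _] := valP (colL j); have o := perm_mem (oriP tL) y.
rewrite mem_cat => /orP[/mem_take|/mem_drop]; by rewrite o mem_enum.
Qed.

(** The nonzero entries of a row sit at the cofaces of its simplex. *)
Lemma row_entries_le2 i :
  nonbranching L q -> (#|[set j | M i j != 0%R]| <= 2)%N.
Proof.
move=> /(_ (rowL i)); apply: leq_trans.
rewrite -(card_imset _ (bij_inj bijC)); apply: subset_leq_card.
apply/subsetP => _ /imsetP[j jM ->]; rewrite inE in jM.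
by rewrite inE; apply: boundary_entry_face.
Qed.

End Faces.

Section Csr.
Context (R : realType) (m n : nat) (M : 'M[R]_(m, n)).
Context (rowptr colind : seq nat) (vals : seq R).
Hypothesis Mcsr : csr M rowptr colind vals.
Hypothesis le2 : forall i, (#|[set j | M i j != 0%R]| <= 2)%N.

Let p := nth 0%N rowptr.
Let d i := (p i.+1 - p i)%N.
Context (c1 c2 : nat -> nat) (v1 v2 : nat -> R).
Hypothesis slotP : forall i, (i < m)%N ->
  [/\ c1 i = slot 0 0%N p d (nth 0%N colind) i,
      c2 i = slot 1 0%N p d (nth 0%N colind) i,
      v1 i = slot 0 0 p d (nth 0 vals) i &
      v2 i = slot 1 0 p d (nth 0 vals) i].

Let entries_of (i : 'I_m) := [seq (val j, M i j) | j <- enum 'I_n & M i j != 0].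

Lemma csr_row (i : 'I_m) : perm_eq (entries_of i)
  [seq (nth 0%N colind k, nth 0 vals k) | k <- iota (p i) (d i)].
Proof. by case: Mcsr => _ [_ _ /(_ i)]; rewrite perm_sym. Qed.

Lemma row_len_le2 (i : 'I_m) : (d i <= 2)%N.
Proof.
have := perm_size (csr_row i); rewrite !size_map size_iota => <-.
apply: leq_trans (le2 i); rewrite [X in (_ <= X)%N]cardE {2}/enum_mem -enumT.
by apply/eq_leq; congr size; apply: eq_filter => j; rewrite /= inE.
Qed.

Lemma mem_csr_row (i : 'I_m) k : (k < d i)%N ->
  (nth 0%N colind (p i + k) < n)%N /\ nth 0 vals (p i + k) != 0.
Proof.
move=> kd; have : (nth 0%N colind (p i + k), nth 0 vals (p i + k)) \in entries_of i.
  rewrite (perm_mem (csr_row i)); apply/mapP; exists (p i + k)%N => //.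
  by rewrite mem_iota leq_addr ltn_add2l.
by case/mapP => j; rewrite mem_filter => /andP[Mij _] [-> ->].
Qed.

Lemma csr_slots_ok : slots_ok m n c1 c2 v1 v2.
Proof.
move=> i im; have [-> -> -> ->] := slotP im; rewrite /slot.
have row k := @mem_csr_row (Ordinal im) k.
split; (case: ifP => [h|_]; last by rewrite eqxx); have [//] := row _ h.
move=> _ _; have h0 : (0 < d i)%N by apply: ltnW.
by rewrite h0; have [] := row _ h0.
Qed.

Lemma csr_row_dot (i : 'I_m) (f : nat -> R) :
  \sum_j M i j * f j = row_dot c1 c2 v1 v2 i f.
Proof.
have -> : \sum_j M i j * f j = \sum_(e <- entries_of i) e.2 * f e.1.
  rewrite big_map big_filter big_enum_cond [RHS]big_mkcond /=.
  by apply: eq_bigr => j _; case: eqP => //= ->; rewrite mul0r.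
rewrite (perm_big _ (csr_row i)) big_map /= /row_dot.
have [-> -> -> ->] := slotP (ltn_ord i); rewrite /slot.
case: (d i) (row_len_le2 i) => [|[|[|//]]] _ /=.
- by rewrite big_nil !mul0r addr0.
- by rewrite big_seq1 addn0 mul0r addr0.
- by rewrite !big_cons big_nil addr0 addn0 addn1.
Qed.

End Csr.

(** * Cost *)

Lemma inverse_ackermann_gt0 n : (0 < inverse_ackermann n)%N.
Proof. by rewrite /inverse_ackermann; case: ex_minnP => k /andP[]. Qed.

Lemma for_cost_le c k N : (k <= N)%N -> (0 < N)%N ->
  (for_cost c k <= for_cost c 1 * N)%N.
Proof.
by rewrite /for_cost mul1n; move: (maxcost c) => x kN N0; nia.
Qed.

Lemma search_cost_le k N : (k <= 4 * N)%N -> (0 < N)%N ->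
  (search_cost k <= search_cost 4 * N)%N.
Proof.
rewrite /search_cost; move: (bcost _) (maxcost _) => b x kN N0; nia.
Qed.

Lemma entries_cost_le k N : (k <= N)%N -> (0 < N)%N ->
  (entries_cost k <= entries_cost 1 * N)%N.
Proof. by rewrite /entries_cost mul1n; move: (maxcost _) => x kN N0; nia. Qed.

Definition program_cost (nL n nK : nat) : nat :=
  (for_cost flag_body nK + (for_cost slots_body nL +
  ((2 + for_cost edges_body nL) + (search_cost (2 * n + 2 * nL) +
  (for_cost norm_body n + (for_cost kill_body nL + entries_cost (nK * nK)))))))%N.

Definition program_constant : nat :=
  (for_cost flag_body 1 + (for_cost slots_body 1 +
  ((2 + for_cost edges_body 1) + (search_cost 4 +
  (for_cost norm_body 1 + (for_cost kill_body 1 + entries_cost 1))))))%N.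

(** A linear bound is enough: the inverse Ackermann function is at least 1, and
    [nL] is at most [(nL - nK) + nK ^ 2]. *)
Lemma program_cost_le nL n nK :
  (program_cost nL n nK <= program_constant *
     maxn 1 ((nL - nK) * inverse_ackermann n + n + nK ^ 2))%N.
Proof.
set N := maxn _ _; have N0 : (0 < N)%N by rewrite leq_max.
have le : ((nL - nK) + n + nK * nK <= N)%N.
  rewrite leq_max; apply/orP; right; rewrite -mulnn !leq_add2r.
  by rewrite leq_pmulr // inverse_ackermann_gt0.
have hK : (nK <= N)%N by nia.
have hL : (nL <= N)%N by nia.
have hn : (n <= N)%N by lia.
have h1 := for_cost_le flag_body hK N0.
have h2 := for_cost_le slots_body hL N0.
have h3 := for_cost_le edges_body hL N0.
have h4 : (search_cost (2 * n + 2 * nL) <= search_cost 4 * N)%N.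
  by apply: search_cost_le => //; lia.
have h5 := for_cost_le norm_body hn N0.
have h6 := for_cost_le kill_body hL N0.
have h7 : (entries_cost (nK * nK) <= entries_cost 1 * N)%N.
  by apply: entries_cost_le => //; lia.
have h8 : (2 <= 2 * N)%N by lia.
have := leq_add h1 (leq_add h2 (leq_add (leq_add h8 h3) (leq_add h4
  (leq_add h5 (leq_add h6 h7))))).
by rewrite -!mulnDl.
Qed.

(** * Assembly *)

Definition slot_arrays (R : realType) (s : state R) c1 c2 (v1 v2 : nat -> R) :=
  let p := narr s 0 in let d i := (p i.+1 - p i)%N in
  forall i, (i < nvar s 0)%N ->
    [/\ c1 i = slot 0 0%N p d (narr s 1) i, c2 i = slot 1 0%N p d (narr s 1) i,
        v1 i = slot 0 0 p d (rarr s 0) i & v2 i = slot 1 0 p d (rarr s 0) i].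

(** Write sets carry every fact established by a pass through the later ones. *)
Lemma program_correct (R : realType) (s : state R) :
  let nL := nvar s 0 in let n := nvar s 1 in let nK := nvar s 2 in
  let inK r := r \in [seq narr s 2 k | k <- iota 0 nK] in
  (forall a r, (2 < a)%N -> narr s a r = 0%N) ->
  (forall a r, (2 < a)%N -> rarr s a r = 0) ->
  (forall c1 c2 v1 v2, slot_arrays s c1 c2 v1 v2 -> slots_ok nL n c1 c2 v1 v2) ->
  computes laplacian_program s (program_cost nL n nK) (fun t =>
    exists c1 c2 v1 v2 lab x norm,
    [/\ slot_arrays s c1 c2 v1 v2,
        forall a, (a < n)%N ->
          (0 < lab a)%N /\ spanned nL n inK c1 c2 v1 v2 lab x a,
        forall i, free_row nL inK i -> v2 i != 0 -> lab (c1 i) = lab (c2 i),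
        forall r, norm_ok nL n inK c1 c2 v1 v2 (rarr s 1) lab x norm r &
        forall i j, (i < nK)%N -> (j < nK)%N -> rarr t 3 (i * nK + j)%N =
          entry c1 c2 v1 v2 (proj lab x norm) (narr s 2 i) (narr s 2 j)
          / rarr s 2 j]).
Proof.
move=> nL n nK inK n0 r0 slotsP.
apply: computes_seq; first by apply: flag_correct => r; apply: n0.
move=> t1 [nv1 na1 ra1] flag1; rewrite -/nK in flag1.
apply: computes_seq.
  have -> : nL = nvar t1 0 by rewrite nv1.
  by apply: slots_correct => r; rewrite ?na1 ?ra1 ?n0 ?r0.
move=> t2 [nv2 na2 ra2] slots2.
have {slots2}slots : slot_arrays s (narr t2 4) (narr t2 5) (rarr t2 4) (rarr t2 5).
  move=> i iL; have := slots2 i; rewrite nv1 // na1 // na1 // ra1 //.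
  by apply.
have ok := slotsP _ _ _ _ slots.
have flag2 r : inK r = (narr t2 3 r != 0%N) by rewrite na2 // flag1.
apply: computes_seq.
  apply: (edges_correct ok _ flag2) => //; first by rewrite nv2 // nv1.
  by move=> a; rewrite na2 // na1 // n0.
move=> t3 [nv3 na3 ra3] [adj [m [G S C]]].
apply: computes_seq.
  apply: (search_correct ok _ _ G S C) => [|a]; first by rewrite nv3 // nv2 // nv1.
  by rewrite na3 // na2 // na1 // n0.
move=> t4 [nv4 na4 ra4] [span edge].
have wtE : rarr t4 1 = rarr s 1 by rewrite ra4 // ra3 // ra2 // ra1.
apply: computes_seq.
  apply: (norm_correct (n := n) _ wtE) => [|r].
    by rewrite nv4 // nv3 // nv2 // nv1.
  by rewrite ra4 // ra3 // ra2 // ra1 // r0.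
move=> t5 [nv5 na5 ra5] norm5.
have labE : narr t5 9 = narr t4 9 by rewrite na5.
have xE : rarr t5 7 = rarr t4 7 by rewrite ra5.
have e4 : narr t5 4 = narr t2 4 by rewrite na5 // na4 // na3.
have e5 : narr t5 5 = narr t2 5 by rewrite na5 // na4 // na3.
have f4 : rarr t5 4 = rarr t2 4 by rewrite ra5 // ra4 // ra3.
have f5 : rarr t5 5 = rarr t2 5 by rewrite ra5 // ra4 // ra3.
apply: computes_seq.
  apply: (kill_correct (nr := nL) (n := n) (inK := inK) (wt := rarr s 1)
    _ _ e4 e5 f4 f5).
  - by rewrite nv5 // nv4 // nv3 // nv2 // nv1.
  - by move=> r; rewrite na5 // na4 // na3.
  - by move=> r; rewrite norm5 labE xE.
move=> t6 [nv6 na6 ra6] norm6.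
have n2 : nvar t6 2 = nK by rewrite nv6 // nv5 // nv4 // nv3 // nv2 // nv1.
have idxE : narr t6 2 = narr s 2 by rewrite na6 // na5 // na4 // na3 // na2 // na1.
have wKE : rarr t6 2 = rarr s 2 by rewrite ra6 // ra5 // ra4 // ra3 // ra2 // ra1.
apply: (computes_impl (entries_correct t6)); first by rewrite n2.
move=> t7 _; rewrite n2 idxE wKE na6 // na6 // na6 // ra6 // ra6 // ra6 //.
rewrite e4 e5 f4 f5 labE xE => out.
exists (narr t2 4), (narr t2 5), (rarr t2 4), (rarr t2 5), (narr t4 9), (rarr t4 7),
  (rarr t6 8); split=> //.
by move=> r; rewrite -labE -xE.
Qed.

Theorem mainTheorem2 :
  exists (P : cmd) (C : nat),
  forall (R : realType) (V : finType) (K L : {set {set V}}) (q : nat)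
    (ori : {set V} -> seq V) (wK wL : {set V} -> R)
    (rowL : 'I_(nsimp L q) -> qsimp L q)
    (colL : 'I_(nsimp L q.+1) -> qsimp L q.+1)
    (rowK : 'I_(nsimp K q) -> qsimp K q)
    (idx : 'I_(nsimp K q) -> 'I_(nsimp L q))
    (rowptr colind : seq nat) (vals : seq R),
  simplicial_complex K -> simplicial_complex L -> K \subset L ->
  nonbranching L q ->
  orientation L ori ->
  {in K, forall s, 0 < wK s} -> {in L, forall s, 0 < wL s} ->
  bijective rowL -> bijective colL -> bijective rowK ->
  (forall i, val (rowL (idx i)) = val (rowK i)) ->
  csr (matrix_in rowL colL (boundary R ori L q)) rowptr colind vals ->
  exists (t : state R) (n : nat),
  [/\ exec P
        (input_state
           [:: nsimp L q; nsimp L q.+1; nsimp K q]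
           [:: rowptr; colind; [seq val (idx i) | i <- enum 'I_(nsimp K q)]]
           [:: vals;
               [seq wL (val (colL j)) | j <- enum 'I_(nsimp L q.+1)];
               [seq wK (val (rowK i)) | i <- enum 'I_(nsimp K q)]])
        t n,
      (n <= C * maxn 1
              ((nsimp L q - nsimp K q) * inverse_ackermann (nsimp L q.+1)
               + nsimp L q.+1 + nsimp K q ^ 2))%N &
      forall i j : 'I_(nsimp K q),
        rarr t 3 (i * nsimp K q + j) =
        matrix_in rowK rowK (up_laplacian ori wK wL K L q) i j].
Proof.
exists laplacian_program, program_constant.
move=> R V K L q ori wK wL rowL colL rowK idx rowptr colind vals.
move=> _ _ KL nb oriP wK0 wL0 bijL bijC bijK idxE Mcsr.
set s := input_state _ _ _; set nL := nsimp L q; set n := nsimp L q.+1.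
set nK := nsimp K q; set M := matrix_in rowL colL _ in Mcsr.
have le2 i : (#|[set j | M i j != 0%R]| <= 2)%N by apply: row_entries_le2.
have nth_out T (z : T) (x y w : seq T) a r : (2 < a)%N ->
    nth z (nth [::] [:: x; y; w] a) r = z.
  by move=> a2; rewrite (@nth_default _ [::] _ a) ?nth_nil.
have [||c1 c2 v1 v2 sl|t [k [e l post]]] := program_correct (s := s).
- by move=> a r; apply: nth_out.
- by move=> a r; apply: nth_out.
- exact: (csr_slots_ok Mcsr sl).
exists t, k; split=> //; first exact: leq_trans l (program_cost_le _ _ _).
move: post => [c1 [c2 [v1 [v2 [lab [x [norm [sl span edge normP out]]]]]]]] i j.
set inK := fun r => _ in span edge normP.
have idxs a : narr s 2 (val a) = val (idx a).
  by rewrite /= (nth_map a) ?size_enum_ord // nth_ord_enum.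
have inKE a : inK (val a) = (a \in codom idx).
  apply/mapP/codomP => [[b]|[b ->]]; rewrite ?mem_iota /= ?add0n.
    move=> bK ab; exists (Ordinal bK); apply: val_inj.
    by rewrite -idxs.
  exists (val b); last exact: (esym (idxs b)).
  by rewrite mem_iota /= ltn_ord.
pose wt := rarr s 1.
have wtE (a : 'I_n) : wt a = wL (val (colL a)).
  by rewrite /wt /= (nth_map a) ?size_enum_ord // nth_ord_enum.
have wt0 a : (a < n)%N -> 0 < wt a.
  move=> an; rewrite -[a]/(val (Ordinal an)) wtE wL0 //.
  by have /andP[] := valP (colL (Ordinal an)).
have ok := csr_slots_ok Mcsr sl; have dot := csr_row_dot Mcsr le2 sl.
have lab0 a an := (span a an).1; have lab_spans a an := (span a an).2.
rewrite (up_laplacian_entry wK wL0 bijL bijC bijK idxE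
  (P := fun a b => proj lab x norm (val a) (val b))); first last.
(* The passes handle functions on naturals, so [u] is extended by 0. *)
- move=> u uP b; pose u' a := if insub a is Some a' then u a' else 0.
  have u'E (a : 'I_n) : u' (val a) = u a by rewrite /u' valK.
  have cu : cycle nL inK c1 c2 v1 v2 u'.
    move=> r /andP[rL rK]; rewrite -[r]/(val (Ordinal rL)) -dot.
    under eq_bigr do rewrite u'E; apply: uP.
    by rewrite -inKE.
  have := proj_dot wt0 ok lab0 lab_spans edge (fun a _ => normP _) (ltn_ord b) cu.
  rewrite u'E => <-; apply: eq_bigr => a _.
  by rewrite u'E wtE.
- move=> b a aK; rewrite -/M (dot a (proj lab x norm ^~ (val b))).
  apply: (proj_cycle ok edge (fun a _ => normP _) (ltn_ord b)).
  by rewrite /free_row ltn_ord /= inKE.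
rewrite out ?ltn_ord // !idxs.
have -> : rarr s 2 j = wK (val (rowK j)).
  by rewrite /= (nth_map j) ?size_enum_ord // nth_ord_enum.
rewrite -/M; set w := _^-1.
transitivity (\sum_a M (idx i) a * (\sum_b M (idx j) b * proj lab x norm a b) * w).
  rewrite -mulr_suml; congr (_ * w).
  under eq_bigr do rewrite (dot (idx j)).
  rewrite (dot (idx i) (fun a => row_dot c1 c2 v1 v2 (idx j) (proj lab x norm a))).
  by rewrite /row_dot /entry; ring.
apply: eq_bigr => a _; rewrite mulr_sumr mulr_suml.
by apply: eq_bigr => b _; ring.
Qed.
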